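(* Let $\Gamma$ be a finite connected non-empty graph with no cycles of length $\ge2$, and let $\omega\colon E\Gamma\to\mathbb Z_{\ge2}$ be an edge weight satisfying $\omega(a)\ge3$ or $\omega(\bar a)\ge3$ for every $a\in E\Gamma$. If $(\Gamma,\omega)$ is unimodular, then $$\chi(\Gamma,u)=\mathcal Z_{\Gamma,u\to u}(-1)^{-1}\qquad\text{for all }u\in\Gamma=V\Gamma\sqcup E\Gamma.$$
   Context: Graphs are in the sense of Serre (vertices $V\Gamma$, edges $E\Gamma$, maps $o,t\colon E\Gamma\to V\Gamma$, fixed-point-free edge inversion $e\mapsto\bar e$, $o(\bar e)=t(e)$). A path is a trivial path at a vertex (length $0$) or a sequence of edges $(a_1,\dots,a_n)$ with $t(a_i)=o(a_{i+1})$ (repetitions and backtracking allowed); it starts at $o(a_1)$, or at $a_1$, and ends at $t(a_n)$, or at $a_n$. It is reduced if $a_{i+1}\ne\bar a_i$ for all $i$. An $n$-cycle is a reduced path $(a_1,\dots,a_n)$, $n\geq 1$, with $o(a_1)=t(a_n)$ and $t(a_i)\ne t(a_j)$ for $i\ne j$. Put $[u]=\{u\}$ for $u\in V\Gamma$ and $[u]=\{u,\bar u\}$ for $u\in E\Gamma$; $\mathcal P_\Gamma(X\to Y)$ is the set of paths starting at some $x\in X$ and ending at some $y\in Y$. For a path $\mathfrak p$: $N_{\rm edg}(\mathfrak p)=\ell(\mathfrak p)$ if $\ell(\mathfrak p)\le1$, $N_{\rm edg}(a_1,\dots,a_n)=\prod_{i=1}^{n-1}(\omega(a_{i+1})-\mathbb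 1_{\{\bar a_i\}}(a_{i+1}))$ if $n\ge2$; $N_{\rm vert}(\mathfrak p)=1$ if $\ell(\mathfrak p)=0$ and $N_{\rm vert}(\mathfrak p)=\omega(a_1)N_{\rm edg}(\mathfrak p)$ if $\mathfrak p=(a_1,\dots,a_n)$, $n\ge1$. For $c\in V\Gamma$, $\mathcal Z_{\Gamma,c\to c}(s)=\sum_{\mathfrak p\in\mathcal P_\Gamma(\{c\}\to\{c\})}N_{\rm vert}(\mathfrak p)^{-s}$; for $a\in E\Gamma$, $\mathcal Z_{\Gamma,a\to a}(s)=1+\sum_{\mathfrak p\in\mathcal P_\Gamma([a]\to[a]),\,\ell(\mathfrak p)\ge2}N_{\rm edg}(\mathfrak p)^{-s}$. Under the stated hypotheses on $\omega$ these converge on some right half-plane and extend meromorphically to $\mathbb C$; $\mathcal Z_{\Gamma,u\to u}(-1)^{-1}$ is the value at $s=-1$ of the meromorphic function $1/\mathcal Z_{\Gamma,u\to u}(s)$. Universal cover: there is an essentially unique tree $T$ with graph epimorphism $\pi\colon T\to\Gamma$ such that for all $a\in E\Gamma$ and $v\in VT$ with $\pi(v)=o(a)$ there are exactly $\omega(a)$ edges $e$ with $o(e)=v$, $\pi(e)=a$. Put $\mathrm{Aut}_\pi(T)=\{\varphi\in\mathrm{Aut}(T):\pi\circ\varphi=\pi\}$, a totally disconnected locally compact group with the permutation topology. $(\Gamma,\omega)$ is unimodular if $\mathrm{Aut}_\pi(T)$ is unimodular (equivalently, $\prod_i\omega(a_i)=\prod_i\omega(\bar a_i)$ for every closed path $(a_1,\dots,a_n)$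 in $\Gamma$). Euler–Poincaré characteristic: for a unimodular t.d.l.c. group $G$ acting on a tree $T$ without edge inversions, with compact open vertex stabilisers and finite quotient graph, and a Haar measure $\mu$ on $G$, one has (a known formula, which may be taken as definition) $\chi(G,\mu)=\sum_{v\in\mathcal V}\frac1{\mu(G_v)}-\sum_{e\in\mathcal E^+}\frac1{\mu(G_e)}$, where $\mathcal V$ and $\mathcal E^+$ are sets of representatives of the $G$-orbits on $VT$ and on a ($G$-invariant) orientation of $T$ (an orientation contains exactly one of $e,\bar e$ for each edge $e$). For $u\in\Gamma$ set $\chi(\Gamma,u)=\chi(G,\mu_{G_t})$, with $G=\mathrm{Aut}_\pi(T)$, $t\in T$ any element with $\pi(t)=u$, and $\mu_{G_t}$ the Haar measure with $\mu_{G_t}(G_t)=1$; this is independent of $t$. *)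

(* Defs.v *)
From HB Require Import structures.
From mathcomp Require Import all_boot all_order all_algebra.
From mathcomp Require Import finmap complex.
From mathcomp Require Import all_classical all_reals all_analysis.
From mathcomp Require summability.

Set Implicit Arguments.
Unset Strict Implicit.
Unset Printing Implicit Defensive.

Import Order.TTheory GRing.Theory Num.Theory.
Import numFieldNormedType.Exports.

Local Open Scope classical_set_scope.
Local Open Scope ring_scope.

Record graph (V E : Type) := Graph {
  org : E -> V;
  tgt : E -> V;
  einv : E -> E;
  einvK : involutive einv;
  einv_neq : forall e, einv e <> e;
  org_einv : forall e, org (einv e) = tgt e }.

Section Paths.
Variables (V E : choiceType) (G : graph V E).

(* [inl v] is the trivial path at [v]; [inr (a, l)] is the sequence of edges
   [a :: l].  Composability is the separate predicate [is_gpath]. *)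
Definition gpath : Type := (V + E * seq E)%type.

Definition composable : rel E := fun a b => tgt G a == org G b.

Definition is_gpath (p : gpath) : bool :=
  if p is inr (a, l) then path composable a l else true.

Definition glength (p : gpath) : nat :=
  if p is inr (_, l) then (size l).+1 else 0%N.

Definition starts_at (p : gpath) (x : V + E) : bool :=
  match p, x with
  | inl v, inl w => v == w
  | inl _, inr _ => false
  | inr (a, _), inl w => org G a == w
  | inr (a, _), inr b => a == b
  end.

Definition ends_at (p : gpath) (y : V + E) : bool :=
  match p, y with
  | inl v, inl w => v == w
  | inl _, inr _ => false
  | inr (a, l), inl w => tgt G (last a l) == w
  | inr (a, l), inr b => last a l == b
  end.

Definition paths_between (X Y : seq (V + E)) (p : gpath) : bool :=
  [&& is_gpath p, has (starts_at p) X & has (ends_at p) Y].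

Definition is_cycle (c : seq E) : bool :=
  if c is a :: l then
    [&& path composable a l,
        path (fun x y => y != einv G x) a l,
        org G a == tgt G (last a l) & uniq (map (tgt G) c)]
  else false.

Definition connected_graph : Prop :=
  forall v w : V, exists p, paths_between [:: inl v] [:: inl w] p.

Definition is_tree : Prop :=
  [/\ inhabited V, connected_graph & forall c, ~~ is_cycle c].

(* [u] = {u} for a vertex, {u, u bar} for an edge *)
Definition cell_class (u : V + E) : seq (V + E) :=
  match u with
  | inl v => [:: inl v]
  | inr a => [:: inr a; inr (einv G a)]
  end.

End Paths.

Arguments gpath : clear implicits.

Section Weights.
Variables (V E : choiceType) (G : graph V E) (w : E -> nat).

(* [pairmap f a l] lists [f a_i a_(i+1)] along [a :: l]; the empty product
   gives the value 1 on paths of length 1.  The subtraction of naturals is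
   exact as soon as [w] is positive. *)
Definition N_edg (p : gpath V E) : nat :=
  if p is inr (a, l) then
    (\prod_(k <- pairmap (fun x y => (w y - (y == einv G x))%N) a l) k)%N
  else 0%N.

Definition N_vert (p : gpath V E) : nat :=
  if p is inr (a, _) then (w a * N_edg p)%N else 1%N.

End Weights.

(* R[i] as a normed space over itself, as for any numFieldType *)
HB.instance Definition _ (R : realType) :=
  PseudoPointedMetric.copy R[i] R[i]^o.
HB.instance Definition _ (R : realType) := GRing.ComAlgebra.copy R[i] R[i]^o.
HB.instance Definition _ (R : realType) := Vector.copy R[i] R[i]^o.
HB.instance Definition _ (R : realType) := NormedModule.copy R[i] R[i]^o.

Section Complex.
Variable R : realType.
Local Notation C := (R[i]).

Definition expC (z : C) : C :=
  (expR (complex.Re z))%:C%C * (cos (complex.Im z) +i* sin (complex.Im z))%C.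

(* n ^ s, meaningful for n > 0 only *)
Definition natpowC (n : nat) (s : C) : C := expC (s * (ln n%:R)%:C%C).

(* Unconditional summation: convergence of the net of finite partial sums. *)
Definition has_sum (I : choiceType) (P : pred I) (f : I -> C) (S : C) : Prop :=
  summability.partial_sum (fun i => if P i then f i else 0)
    @ @summability.totally I --> S.

Definition holomorphic_at (f : C -> C) (z : C) : Prop :=
  \forall x \near z, derivable f x 1.

(* Locally a quotient of two holomorphic functions, the denominator having no
   zero except possibly at the centre.  The value of [F] at the centre itself
   is irrelevant, so that [F] may be total. *)
Definition meromorphic (F : C -> C) : Prop :=
  forall z : C, exists g h : C -> C,
    [/\ holomorphic_at g z, holomorphic_at h z &
        \forall x \near z^', h x != 0 /\ F x = g x / h x].

(* [D s z] reads "the series at [s] converges, with sum [z]". *)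
Definition meromorphic_extension (D : C -> C -> Prop) (F : C -> C) : Prop :=
  meromorphic F /\ exists sigma : R, forall s : C, sigma < complex.Re s -> D s (F s).

(* The meromorphic extension to the plane of a function on a half-plane is
   unique (away from isolated points), so this says that it exists and that
   its inverse has value [c] at [s0]; in particular c = 0 at a pole. *)
Definition inverse_value (D : C -> C -> Prop) (s0 c : C) : Prop :=
  exists2 F, meromorphic_extension D F & (fun s => (F s)^-1) @ s0^' --> c.

Section Zeta.
Variables (V E : choiceType) (G : graph V E) (w : E -> nat).

Definition zeta_series (u : V + E) (s z : C) : Prop :=
  let P := paths_between G (cell_class G u) (cell_class G u) in
  match u with
  | inl _ => has_sum P (fun p => natpowC (N_vert G w p) (- s)) z
  | inr _ =>
      exists2 S, has_sum (fun p => P p && (2 <= glength p)%N)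
                         (fun p => natpowC (N_edg G w p) (- s)) S
               & z = 1 + S
  end.

End Zeta.
End Complex.

Record ghom (V E V' E' : Type) (G : graph V E) (G' : graph V' E') := GHom {
  homV : V -> V';
  homE : E -> E';
  hom_org : forall e, homV (org G e) = org G' (homE e);
  hom_einv : forall e, homE (einv G e) = einv G' (homE e) }.

Section Hom.
Variables (V E V' E' V'' E'' : Type).
Variables (G : graph V E) (G' : graph V' E') (G'' : graph V'' E'').

Definition hom_cell (f : ghom G G') (x : V + E) : V' + E' :=
  match x with inl v => inl (homV f v) | inr e => inr (homE f e) end.

Lemma hom_tgt (f : ghom G G') e : homV f (tgt G e) = tgt G' (homE f e).
Proof. by rewrite -!org_einv hom_org hom_einv. Qed.

Lemma hom_cell_inj : injective hom_cell.
Proof.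
move=> f g fg.
have eV : homV f = homV g.
  by apply/funext => v; have := congr1 (@^~ (inl v)) fg => -[].
have eE : homE f = homE g.
  by apply/funext => e; have := congr1 (@^~ (inr e)) fg => -[].
case: f g eV eE {fg} => [a b p q] [a' b' p' q'] /= eV eE.
by subst a' b'; congr GHom; exact: Prop_irrelevance.
Qed.

Definition id_hom : ghom G G :=
  @GHom _ _ _ _ G G id id (fun=> erefl) (fun=> erefl).

Lemma comp_hom_org (g : ghom G' G'') (f : ghom G G') e :
  (homV g \o homV f) (org G e) = org G'' ((homE g \o homE f) e).
Proof. by rewrite /= !hom_org. Qed.

Lemma comp_hom_einv (g : ghom G' G'') (f : ghom G G') e :
  (homE g \o homE f) (einv G e) = einv G'' ((homE g \o homE f) e).
Proof. by rewrite /= !hom_einv. Qed.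

Definition comp_hom (g : ghom G' G'') (f : ghom G G') : ghom G G'' :=
  GHom (comp_hom_org g f) (comp_hom_einv g f).

End Hom.

Lemma id_homE (V E : Type) (G : graph V E) x : hom_cell (id_hom G) x = x.
Proof. by case: x. Qed.

Lemma comp_homE (V E V' E' V'' E'' : Type) (G : graph V E) (G' : graph V' E')
    (G'' : graph V'' E'') (g : ghom G' G'') (f : ghom G G') x :
  hom_cell (comp_hom g f) x = hom_cell g (hom_cell f x).
Proof. by case: x. Qed.

Definition is_universal_cover (V E VT ET : choiceType)
    (G : graph V E) (w : E -> nat) (T : graph VT ET) (prj : ghom T G) : Prop :=
  [/\ is_tree T,
      (forall x, exists y, hom_cell prj y = x) &
      forall (a : E) (v : VT), homV prj v = org G a ->
        ([set e | org T e = v /\ homE prj e = a] #= `I_(w a))%card].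

HB.mixin Record isTopologicalGroup G of Group G & PointedTopological G := {
  mulg_continuous : continuous (fun x : G * G => (x.1 * x.2)%g);
  invg_continuous : continuous (fun x : G => x^-1)%g }.

#[short(type="topologicalGroupType")]
HB.structure Definition TopologicalGroup :=
  {G of Group G & PointedTopological G & isTopologicalGroup G}.

Section Haar.
Variables (R : realType) (G : topologicalGroupType).

Definition borel : Type := g_sigma_algebraType (@open G).

HB.instance Definition _ := Measurable.on borel.

Variable mu : {measure set borel -> \bar R}.

(* The last two conditions are the regularity of a Radon measure (automatic
   when the group is second countable). *)
Definition left_haar : Prop :=
  [/\ forall (g : G) (A : set G), measurable (A : set borel) ->
        mu [set g * x | x in A]%g = mu A,
      forall K : set G, compact K -> (mu K < +oo)%E,
      forall U : set G, open U -> U !=set0 -> (0 < mu U)%E,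
      forall A : set G, measurable (A : set borel) ->
        mu A = ereal_inf [set mu U | U in [set U : set G | open U /\ A `<=` U]]
    & forall U : set G, open U ->
        mu U = ereal_sup
          [set mu K | K in [set K : set G | compact K /\ K `<=` U]]].

Definition right_invariant : Prop :=
  forall (g : G) (A : set G), measurable (A : set borel) ->
    mu [set x * g | x in A]%g = mu A.

End Haar.

Definition unimodular (R : realType) (G : topologicalGroupType) : Prop :=
  forall mu : {measure set (borel G) -> \bar R},
    left_haar mu -> right_invariant mu.

(* The inverse is stored, but determined by [aut_hom]: see [act_inj]. *)
Record aut_pi (VT ET V E : Type) (T : graph VT ET) (G : graph V E)
    (prj : ghom T G) := AutPi {
  aut_hom : ghom T T;
  aut_inv : ghom T T;
  autK : cancel (hom_cell aut_hom) (hom_cell aut_inv);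
  autVK : cancel (hom_cell aut_inv) (hom_cell aut_hom);
  autpiE : forall x, hom_cell prj (hom_cell aut_hom x) = hom_cell prj x }.

Section AutPi.
Variables (VT ET V E : choiceType) (T : graph VT ET) (G : graph V E).
Variable prj : ghom T G.
Local Notation A := (aut_pi prj).

Definition act (g : A) (x : VT + ET) : VT + ET := hom_cell (aut_hom g) x.

Lemma act_inj : injective act.
Proof.
move=> g h gh; have e1 : aut_hom g = aut_hom h by exact: hom_cell_inj.
have e2 : aut_inv g = aut_inv h.
  apply: hom_cell_inj; apply/funext => x.
  by rewrite -{1}[x](autVK h) -e1 autK.
case: g h e1 e2 {gh} => [a b p q r] [a' b' p' q' r'] /= e1 e2.
by subst a' b'; congr AutPi; exact: Prop_irrelevance.
Qed.

HB.instance Definition _ := gen_eqMixin A.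
HB.instance Definition _ := gen_choiceMixin A.

Definition aut_one : A.
Proof.
by exists (id_hom T) (id_hom T); move=> x; rewrite !id_homE.
Defined.

Definition aut_mul (g h : A) : A.
Proof.
exists (comp_hom (aut_hom g) (aut_hom h)) (comp_hom (aut_inv h) (aut_inv g)).
- by move=> x; rewrite !comp_homE !autK.
- by move=> x; rewrite !comp_homE !autVK.
- by move=> x; rewrite !comp_homE !autpiE.
Defined.

Definition aut_invg (g : A) : A.
Proof.
exists (aut_inv g) (aut_hom g); [exact: autVK|exact: autK|].
by move=> x; rewrite -(autpiE g) autVK.
Defined.

Lemma act_mul g h x : act (aut_mul g h) x = act g (act h x).
Proof. exact: comp_homE. Qed.
Lemma act_one x : act aut_one x = x. Proof. exact: id_homE. Qed.
Lemma act_invK g : cancel (act g) (act (aut_invg g)). Proof. exact: autK. Qed.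
Lemma act_Kinv g : cancel (act (aut_invg g)) (act g). Proof. exact: autVK. Qed.

Lemma aut_mulA : associative aut_mul.
Proof. by move=> f g h; apply/act_inj/funext => x; rewrite !act_mul. Qed.
Lemma aut_mul1 : left_id aut_one aut_mul.
Proof. by move=> g; apply/act_inj/funext => x; rewrite act_mul act_one. Qed.
Lemma aut_1mul : right_id aut_one aut_mul.
Proof. by move=> g; apply/act_inj/funext => x; rewrite act_mul act_one. Qed.
Lemma aut_mulV : left_inverse aut_one aut_invg aut_mul.
Proof.
by move=> g; apply/act_inj/funext => x; rewrite act_mul act_one act_invK.
Qed.
Lemma aut_Vmul : right_inverse aut_one aut_invg aut_mul.
Proof.
by move=> g; apply/act_inj/funext => x; rewrite act_mul act_one act_Kinv.
Qed.

HB.instance Definition _ :=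
  isGroup.Build A aut_mulA aut_mul1 aut_1mul aut_mulV aut_Vmul.
HB.instance Definition _ := isPointed.Build A aut_one.

(* The permutation topology: the cosets of the pointwise stabilisers of finite
   sets of cells form a base. *)
Definition perm_open : set_system A :=
  [set U | forall g, U g -> exists F : seq (VT + ET),
     forall h, {in F, act h =1 act g} -> U h].

Lemma perm_openT : perm_open setT.
Proof. by move=> g _; exists [::]. Qed.

Lemma perm_openI : setI_closed perm_open.
Proof.
move=> U W oU oW g [/oU[F1 h1] /oW[F2 h2]]; exists (F1 ++ F2) => h hF.
by split; [apply: h1|apply: h2] => x xF; apply: hF; rewrite mem_cat xF ?orbT.
Qed.

Lemma perm_open_bigU (I : Type) (f : I -> set A) :
  (forall i, perm_open (f i)) -> perm_open (\bigcup_i f i).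
Proof.
move=> of_ g [i _ /(of_ i)[F hF]]; exists F => h /hF fih.
by exists i.
Qed.

HB.instance Definition _ :=
  isOpenTopological.Build A perm_openT perm_openI perm_open_bigU.

Lemma nbhs_autP (g : A) (U : set A) :
  nbhs g U <-> exists F : seq (VT + ET), forall h, {in F, act h =1 act g} -> U h.
Proof.
split; first by case=> W [oW Wg WU]; have [F hF] := oW _ Wg; exists F => h /hF /WU.
case=> F hF; exists [set h | {in F, act h =1 act g}]; split => //.
by move=> h hg; exists F => k kh x xF; rewrite kh// hg.
Qed.

Lemma aut_mulg_continuous : continuous (fun x : A * A => (x.1 * x.2)%g).
Proof.
move=> [g h] U /nbhs_autP[F hF].
exists ([set k | {in [seq act h x | x <- F], act k =1 act g}],
        [set k | {in F, act k =1 act h}]).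
  by split; apply/nbhs_autP; [exists [seq act h x | x <- F]|exists F].
move=> [k l] /= [kg lh]; apply: hF => x xF.
by rewrite !act_mul lh// kg// map_f.
Qed.

Lemma aut_invg_continuous : continuous (fun x : A => x^-1)%g.
Proof.
move=> g U /nbhs_autP[F hF]; apply/nbhs_autP.
exists [seq act (aut_invg g) x | x <- F] => h hg; apply: hF => x xF.
apply: (can_inj (act_invK h)); rewrite act_Kinv.
by rewrite hg ?map_f// act_Kinv.
Qed.

HB.instance Definition _ :=
  isTopologicalGroup.Build A aut_mulg_continuous aut_invg_continuous.

Definition stab (x : VT + ET) : set A := [set g | act g x = x].

(* [B] meets each orbit contained in the invariant set [X] exactly once *)
Definition orbit_representatives (X B : set (VT + ET)) : Prop :=
  B `<=` X /\
  forall x, X x -> exists! b, B b /\ exists g : A, act g x = b.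

Definition vertices : set (VT + ET) := range inl.

Definition invariant_orientation (O : set (VT + ET)) : Prop :=
  [/\ O `<=` range inr,
      forall e : ET, O (inr e) <-> ~ O (inr (einv T e)) &
      forall (g : A) x, O x -> O (act g x)].

(* For sets of orbit representatives of vertices and of edges of an invariant
   orientation; these sets are finite when the base graph is, and stabilisers
   have finite positive measure for a Haar measure. *)
Definition euler_char (R : realType) (mu : {measure set (borel A) -> \bar R})
    (Bv Be : set (VT + ET)) : R :=
  \sum_(v \in Bv) (fine (mu (stab v)))^-1
  - \sum_(e \in Be) (fine (mu (stab e)))^-1.

End AutPi.

Arguments stab {VT ET V E T G} prj x.
Arguments vertices : clear implicits.
Arguments orbit_representatives {VT ET V E T G} prj X B.
Arguments invariant_orientation {VT ET V E T G} prj O.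
Arguments zeta_series {R V E} G w u s z.

(* Main.v *)
(* Let c(x) = 1 / mu(G_x) be the inverse Haar measure of the stabiliser of a cell x
   of T.  Automorphisms over Gamma act transitively on the fibres of pi, so
   mu(G_{o(e)}) = w(a) mu(G_e) for e over a, and c descends to Gamma by
   unimodularity, with c(a) = c(abar) = w(a) c(o(a)) and
   chi = sum_v c(v) - (1/2) sum_a c(a).

   For Re s large the zeta function is read off the solution x of
   x = y + K(s) x, where K(s)_{ab} = (w(b) - [b = abar])^{-s} when t(a) = o(b) and
   y is supported on the final cells; Cramer's rule writes it as a quotient of
   exponential polynomials.  On loops, unimodularity gives w(a) = w(abar), and
   symmetry of the data allows [b = abar] to be replaced there by [b = a].

   At s = -1 the equation reads x(a) + x(abar) = f(t(a)) + y(a) with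
   f(v) = sum_{o(b) = v} w(b) x(b).  Comparing a with abar shows that f is constant
   up to the source term; weighting the definition of f by c and summing over v
   gives (value of zeta) * chi = c(u) = 1.  The homogeneous equation only has the
   zero solution: chi <> 0 kills the constant, and what remains is an
   antisymmetric flow without sources, vanishing on loops, on a graph all of whose
   cycles are loops. *)
Require Import Defs.
From HB Require Import structures.
From mathcomp Require Import all_boot all_order all_algebra.
From mathcomp Require Import finmap complex.
From mathcomp Require Import all_classical all_reals all_analysis.
From mathcomp Require summability.
From mathcomp Require Import ring lra zify.

Set Implicit Arguments.
Unset Strict Implicit.
Unset Printing Implicit Defensive.

Import Order.TTheory GRing.Theory Num.Theory.
Import numFieldNormedType.Exports.

Local Open Scope classical_set_scope.
Local Open Scope ring_scope.

(** * Exponential polynomials in a complex variable *)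

(** A matrix entry with base [2 - 1] has absolute value 1 for every [s], so convergence for large Re
    s is not a matter of small entries. The condition that [w a] or [w (einv G a)] is at least 3
    prevents two such entries from following one another, and a norm with weights 1 and 2 turns this
    into a contraction. The exceptional entry is moved on loops for a reason at s = -1. If a is a
    loop, the vector equal to 1 at a, to -1 at abar and to 0 elsewhere is fixed by the original
    K(-1), because w(a) = w(abar); the determinant of 1 - K(s) would vanish exactly at the point of
    interest, and Cramer's rule would give no value there. A cycle of length at least 2 has the same
    effect: the unit circulation along it, divided by the edge weights c(a), is fixed by K(-1). This
    is where the hypothesis on cycles enters. *)

Section ExpC.
Variable R : realType.
Local Notation C := (R[i]).
Implicit Types (z w : C) (x y t : R).

Lemma expC0 : expC (0 : C) = 1.
Proof. by rewrite /expC /= expR0 cos0 sin0 mul1r. Qed.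

Lemma expCD z w : expC (z + w) = expC z * expC w.
Proof.
case: z w => a b [c d]; rewrite /expC/= expRD cosD sinD.
simpc; apply/eqP; rewrite eq_complex /=; apply/andP; split; apply/eqP; ring.
Qed.

Lemma norm_expC z : `|expC z| = (expR (complex.Re z))%:C%C.
Proof.
rewrite /expC normrM ger0_norm ?ler0c ?expR_ge0//.
by rewrite normc_def /= cos2Dsin2 sqrtr1 mulr1.
Qed.

End ExpC.

Section Taylor.
Variable R : realType.
Local Notation C := (R[i]).

Lemma segment_mvt_bound (f df : R -> R) (M t : R) : 0 <= t <= 1 -> f 0 = 0 ->
  (forall x : R, is_derive x 1 f (df x)) -> (forall x, 0 <= x <= 1 -> `|df x| <= M) ->
  `|f t| <= M.
Proof.
move=> /andP[t0 t1] f0 fdf dfM.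
have cf : {within `[0, t], continuous f}.
  apply: continuous_subspaceT => x.
  by apply/differentiable_continuous/derivable1_diffP; case: (fdf x).
have [c] := @MVT_segment R f df 0 t t0 (fun x _ => fdf x) cf.
rewrite in_itv/= f0 !subr0 => /andP[c0 ct] ->.
rewrite normrM (ger0_norm t0) -[leRHS]mulr1 ler_pM//.
by apply: dfM; rewrite c0 (le_trans ct).
Qed.

Lemma is_derive_expR_cos (x y s : R) :
  is_derive s 1 (fun t : R => expR (t * x) * cos (t * y))
    (x * (expR (s * x) * cos (s * y)) - y * (expR (s * x) * sin (s * y))) /\
  is_derive s 1 (fun t : R => expR (t * x) * sin (t * y))
    (x * (expR (s * x) * sin (s * y)) + y * (expR (s * x) * cos (s * y))).
Proof.
have dm (a : R) : is_derive s 1 (fun t : R => t * a) a.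
  have -> : (fun t : R => t * a) = a \*: @id R.
    by apply/funext => t; rewrite /GRing.scale /= mulrC.
  by apply: is_derive_eq; rewrite /GRing.scale /= mulr1.
have de := @is_derive1_comp R expR (fun t : R => t * x) s _ _ (is_derive_expR (s * x)) (dm x).
have dc := @is_derive1_comp R cos (fun t : R => t * y) s _ _ (is_derive_cos (s * y)) (dm y).
have ds := @is_derive1_comp R sin (fun t : R => t * y) s _ _ (is_derive_sin (s * y)) (dm y).
split.
  by apply: is_derive_eq (is_deriveM de dc) _; rewrite /GRing.scale /=; ring.
by apply: is_derive_eq (is_deriveM de ds) _; rewrite /GRing.scale /=; ring.
Qed.

(* The real and imaginary parts of the Taylor remainder along [t |-> t * z]
   satisfy r' = z r (one order lower), so each order gains a factor |z|. *)
Lemma expC_taylor_segment (z : C) (rho : R) (j : nat) :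
  `|complex.Re z| <= rho -> `|complex.Im z| <= rho -> rho <= 1 ->
  let a i := complex.Re (z ^+ i) / i`!%:R in
  let b i := complex.Im (z ^+ i) / i`!%:R in
  forall t, 0 <= t <= 1 ->
  `|expR (t * complex.Re z) * cos (t * complex.Im z) - \sum_(i < j) a i * t ^+ i|
     <= expR 1 * 2 ^+ j * rho ^+ j /\
  `|expR (t * complex.Re z) * sin (t * complex.Im z) - \sum_(i < j) b i * t ^+ i|
     <= expR 1 * 2 ^+ j * rho ^+ j.
Proof.
move=> zx zy rho1 a b.
have aS i : a i.+1 * i.+1%:R = complex.Re z * a i - complex.Im z * b i.
  have i0 : i.+1%:R != 0 :> R by [].
  have i1 : i`!%:R != 0 :> R by rewrite pnatr_eq0 -lt0n fact_gt0.
  rewrite /a /b exprS factS natrM.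
  move: (i.+1%:R : R) (i`!%:R : R) i0 i1 => m n m0 n0.
  case: (z) (z ^+ i) => x y [u v] /=; field.
  by rewrite m0 n0.
have bS i : b i.+1 * i.+1%:R = complex.Re z * b i + complex.Im z * a i.
  have i0 : i.+1%:R != 0 :> R by [].
  have i1 : i`!%:R != 0 :> R by rewrite pnatr_eq0 -lt0n fact_gt0.
  rewrite /a /b exprS factS natrM.
  move: (i.+1%:R : R) (i`!%:R : R) i0 i1 => m n m0 n0.
  case: (z) (z ^+ i) => x y [u v] /=; field.
  by rewrite m0 n0.
have a0 : a 0%N = 1 by rewrite /a expr0 /= fact0 divr1.
have b0 : b 0%N = 0 by rewrite /b expr0 /= mul0r.
move: a b aS bS a0 b0 zx zy; move: (complex.Re z) (complex.Im z) => {z} x y.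
move=> a b aS bS a0 b0 xrho yrho.
have rho0 : 0 <= rho by exact: le_trans xrho.
elim: j => [|j IH].
  move=> t /andP[t0 t1]; rewrite !big_ord0 !subr0 !expr0 !mulr1.
  have ex : expR (t * x) <= expR 1.
    rewrite ler_expR (le_trans (ler_norm _))// normrM ger0_norm//.
    by rewrite mulr_ile1// (le_trans xrho).
  split; rewrite normrM ger0_norm ?expR_ge0// -[leRHS]mulr1 ler_pM ?expR_ge0//.
    by rewrite ler_norml cos_geN1 cos_le1.
  by rewrite ler_norml sin_geN1 sin_le1.
set r := fun t => expR (t * x) * cos (t * y) - \sum_(i < j) a i * t ^+ i in IH.
set q := fun t => expR (t * x) * sin (t * y) - \sum_(i < j) b i * t ^+ i in IH.
have sum_der (c : nat -> R) (t : R) :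
    is_derive t 1 (fun t : R => \sum_(i < j.+1) c i * t ^+ i)
      (\sum_(i < j) c i.+1 * i.+1%:R * t ^+ i).
  have H := @is_derive_sum R R R j.+1 (fun i t => c i * t ^+ i) t 1
    (fun i => c i * (i%:R * t ^+ i.-1)).
  have E : \sum_(i < j) c i.+1 * i.+1%:R * t ^+ i =
      \sum_(i < j.+1) c i * (i%:R * t ^+ i.-1).
    rewrite [RHS]big_ord_recl mulr0n mul0r mulr0 add0r.
    by apply: eq_bigr => i _; rewrite mulrA.
  rewrite E.
  have -> : (fun t : R => \sum_(i < j.+1) c i * t ^+ i) =
    \sum_(i < j.+1) (fun t : R => c i * t ^+ i).
    by apply/funext => s; rewrite fct_sumE.
  apply: H => i; have -> : (fun t : R => c i * t ^+ i) = c i \*: (@id R ^+ i).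
    by apply/funext => s; rewrite /GRing.scale /= exprfctE.
  apply: is_derive_eq.
  by rewrite /GRing.scale /= mulr1.
(* The derivative of each remainder combines both remainders of lower order with coefficients Re z
   and Im z, each at most [rho]; the two terms produce the factor 2 per order. *)
have gain : expR 1 * 2 ^+ j.+1 * rho ^+ j.+1 =
    rho * (expR 1 * 2 ^+ j * rho ^+ j) + rho * (expR 1 * 2 ^+ j * rho ^+ j).
  by rewrite !exprS; ring.
have bnd (u v e f : R) M : `|u| <= rho -> `|v| <= rho -> `|e| <= M -> `|f| <= M ->
    `|u * e + v * f| <= rho * M + rho * M.
  move=> *; rewrite (le_trans (ler_normD _ _))// !normrM lerD// ler_pM//.
rewrite gain => t ht; split.
- apply: (@segment_mvt_bound
    (fun t => expR (t * x) * cos (t * y) - \sum_(i < j.+1) a i * t ^+ i)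
    (fun t => x * r t - y * q t)) => //.
  + rewrite !mul0r expR0 cos0 big_ord_recl big1 ?expr0 ?a0; last first.
      by move=> i _; rewrite expr0n mulr0.
    by rewrite !mulr1 addr0 subrr.
  + move=> s; have [dc ds] := is_derive_expR_cos x y s.
    apply: is_derive_eq (is_deriveB dc (sum_der a s)) _.
    rewrite /r /q !mulrBr.
    have -> : \sum_(i < j) a i.+1 * i.+1%:R * s ^+ i =
      x * (\sum_(i < j) a i * s ^+ i) - y * (\sum_(i < j) b i * s ^+ i).
      rewrite !mulr_sumr -sumrB; apply: eq_bigr => i _.
      by rewrite aS; ring.
    ring.
  + move=> s /IH[h1 h2]; rewrite -mulNr; apply: bnd => //; by rewrite normrN.
- apply: (@segment_mvt_bound
    (fun t => expR (t * x) * sin (t * y) - \sum_(i < j.+1) b i * t ^+ i)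
    (fun t => x * q t + y * r t)) => //.
  + rewrite !mul0r expR0 sin0 mulr0 big_ord_recl big1 ?expr0 ?b0; last first.
      by move=> i _; rewrite expr0n mulr0.
    by rewrite mul0r addr0 subrr.
  + move=> s; have [dc ds] := is_derive_expR_cos x y s.
    apply: is_derive_eq (is_deriveB ds (sum_der b s)) _.
    rewrite /r /q !mulrBr.
    have -> : \sum_(i < j) b i.+1 * i.+1%:R * s ^+ i =
      x * (\sum_(i < j) b i * s ^+ i) + y * (\sum_(i < j) a i * s ^+ i).
      rewrite !mulr_sumr -big_split; apply: eq_bigr => i _.
      by rewrite bS /=; ring.
    ring.
  + by move=> s /IH[h1 h2]; apply: bnd.
Qed.

End Taylor.

Section ExpPoly.
Variable R : realType.
Local Notation C := (R[i]).

Lemma Re_sum (I : Type) (r : seq I) (F : I -> C) :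
  complex.Re (\sum_(i <- r) F i) = \sum_(i <- r) complex.Re (F i).
Proof. by apply: (big_morph (@complex.Re R)) => // -[a b] [c d]. Qed.

Lemma Im_sum (I : Type) (r : seq I) (F : I -> C) :
  complex.Im (\sum_(i <- r) F i) = \sum_(i <- r) complex.Im (F i).
Proof. by apply: (big_morph (@complex.Im R)) => // -[a b] [c d]. Qed.

Lemma normc_ReIm (z : C) : `|z| <= (`|complex.Re z| + `|complex.Im z|)%:C%C.
Proof.
have -> : (`|complex.Re z| + `|complex.Im z|)%:C%C =
  `|(complex.Re z)%:C%C| + `|'i%C * (complex.Im z)%:C%C|.
  rewrite normrM !normc_def /= !expr0n !expr1n /= !addr0 !add0r.
  by rewrite sqrtr1 !sqrtr_sqr mul1r rmorphD.
by rewrite {1}[z]complexE ler_normD.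
Qed.

Lemma normc_ge_Im (z : C) : `|complex.Im z|%:C%C <= `|z|.
Proof.
rewrite normc_def lecR -sqrtr_sqr ler_wsqrtr//.
by rewrite lerDr sqr_ge0.
Qed.

Lemma normcE_real (z : C) : `|z| = (complex.Re `|z|)%:C%C.
Proof. by rewrite normc_def. Qed.

(** Order 2 yields the derivative of the exponential, and arbitrary order the leading term of an
    exponential polynomial at a point, so no power series has to be summed. *)
Lemma expC_taylor (j : nat) : exists2 K : C, 0 <= K & forall z : C, `|z| <= 1 ->
  `|expC z - \sum_(i < j) z ^+ i / i`!%:R| <= K * `|z| ^+ j.
Proof.
exists (2 * (expR 1 * 2 ^+ j))%:C%C.
  by rewrite ler0c !mulr_ge0 ?expR_ge0 ?exprn_ge0.
move=> z z1.
set rho := complex.Re `|z|.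
have zrho : `|z| = rho%:C%C by exact: normcE_real.
have hx : `|complex.Re z| <= rho by rewrite -lecR -zrho normc_ge_Re.
have hy : `|complex.Im z| <= rho by rewrite -lecR -zrho normc_ge_Im.
have rho1 : rho <= 1 by rewrite -lecR -zrho.
have t01 : 0 <= (1 : R) <= 1 by rewrite ler01 lexx.
have /= := expC_taylor_segment j hx hy rho1 t01.
rewrite !mul1r => -[h1 h2].
have invn n : (n%:R^-1 : C) = (n%:R^-1)%:C%C by rewrite fmorphV rmorph_nat.
have hR (w : C) n : complex.Re (w / n%:R) = complex.Re w / n%:R.
  by rewrite invn; case: w => a b /=; rewrite mulr0 subr0.
have hI (w : C) n : complex.Im (w / n%:R) = complex.Im w / n%:R.
  by rewrite invn; case: w => a b /=; rewrite mulr0 add0r.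
apply: le_trans (normc_ReIm _) _; rewrite zrho.
have -> : (2 * (expR 1 * 2 ^+ j))%:C%C * rho%:C%C ^+ j =
    (2 * (expR 1 * 2 ^+ j) * rho ^+ j)%:C%C by rewrite [RHS]rmorphM rmorphXn.
rewrite lecR.
have -> : complex.Re (expC z - \sum_(i < j) z ^+ i / i`!%:R) =
   expR (complex.Re z) * cos (complex.Im z) -
    \sum_(i < j) complex.Re (z ^+ i) / i`!%:R * 1 ^+ i.
  have -> (u v : C) : complex.Re (u - v) = complex.Re u - complex.Re v.
    by case: u v => ? ? [].
  rewrite Re_sum /expC /= mul0r subr0; congr (_ - _).
  by apply: eq_bigr => i _; rewrite hR expr1n mulr1.
have -> : complex.Im (expC z - \sum_(i < j) z ^+ i / i`!%:R) =
   expR (complex.Re z) * sin (complex.Im z) -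
    \sum_(i < j) complex.Im (z ^+ i) / i`!%:R * 1 ^+ i.
  have -> (u v : C) : complex.Im (u - v) = complex.Im u - complex.Im v.
    by case: u v => ? ? [].
  rewrite Im_sum /expC /= mul0r addr0; congr (_ - _).
  by apply: eq_bigr => i _; rewrite hI expr1n mulr1.
by rewrite (le_trans (lerD h1 h2))//; lra.
Qed.

(** These functions form a ring containing every [n ^ (-s)], hence also the determinant and the
    adjugate entries of 1 - K(s). They are entire, and unless identically zero they have isolated
    zeros: this is all the complex analysis that the continuation requires. *)
Definition exppoly (f : C -> C) := exists s : seq (C * C),
  forall z, f z = \sum_(p <- s) p.1 * expC (p.2 * z).

Lemma exppoly_cst c : exppoly (fun=> c).
Proof. by exists [:: (c, 0)] => z; rewrite big_seq1 /= mul0r expC0 mulr1. Qed.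

Lemma exppolyD f g : exppoly f -> exppoly g -> exppoly (fun z => f z + g z).
Proof. by move=> [s fs] [t gt]; exists (s ++ t) => z; rewrite big_cat fs gt. Qed.

Lemma exppolyM f g : exppoly f -> exppoly g -> exppoly (fun z => f z * g z).
Proof.
move=> [s fs] [t gt].
exists [seq (p.1 * q.1, p.2 + q.2) | p <- s, q <- t] => z.
rewrite big_allpairs_dep /= fs gt mulr_suml; apply: eq_bigr => p _.
rewrite mulr_sumr; apply: eq_bigr => q _ /=.
by rewrite mulrDl expCD; ring.
Qed.

Lemma exppoly_sum (I : Type) (r : seq I) (P : pred I) (F : I -> C -> C) :
  (forall i, exppoly (F i)) -> exppoly (fun z => \sum_(i <- r | P i) F i z).
Proof.
move=> hF; elim: r => [|i r IH].
  have [s hs] := exppoly_cst 0; exists s => z; rewrite big_nil; exact: hs.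
case: (boolP (P i)) => Pi.
  have [s hs] := exppolyD (hF i) IH; exists s => z; rewrite big_cons Pi; exact: hs.
by have [s hs] := IH; exists s => z; rewrite big_cons (negbTE Pi); exact: hs.
Qed.

Lemma exppoly_prod (I : Type) (r : seq I) (P : pred I) (F : I -> C -> C) :
  (forall i, exppoly (F i)) -> exppoly (fun z => \prod_(i <- r | P i) F i z).
Proof.
move=> hF; elim: r => [|i r IH].
  have [s hs] := exppoly_cst 1; exists s => z; rewrite big_nil; exact: hs.
case: (boolP (P i)) => Pi.
  have [s hs] := exppolyM (hF i) IH; exists s => z; rewrite big_cons Pi; exact: hs.
by have [s hs] := IH; exists s => z; rewrite big_cons (negbTE Pi); exact: hs.
Qed.

Lemma exppoly_ext f g : f =1 g -> exppoly f -> exppoly g.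
Proof. by move=> fg [s hs]; exists s => z; rewrite -fg. Qed.

Lemma exppoly_det n (M : C -> 'M[C]_n) :
  (forall i j, exppoly (fun z => M z i j)) -> exppoly (fun z => \det (M z)).
Proof.
move=> hM; rewrite /determinant; apply: exppoly_sum => s.
by apply: exppolyM; [exact: exppoly_cst|apply: exppoly_prod].
Qed.

Lemma exppoly_adj n (M : C -> 'M[C]_n) i j :
  (forall i j, exppoly (fun z => M z i j)) -> exppoly (fun z => (\adj (M z)) i j).
Proof.
move=> hM; apply: (@exppoly_ext (fun z => cofactor (M z) j i)).
  by move=> z; rewrite mxE.
rewrite /cofactor; apply: exppolyM; first exact: exppoly_cst.
apply: exppoly_det => k l; apply: exppoly_ext (hM (lift j k) (lift i l)) => z.
by rewrite !mxE.
Qed.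

Lemma exppoly_natpowC n : exppoly (fun z => natpowC n (- z)).
Proof.
exists [:: (1, - (ln n%:R)%:C%C)] => z.
by rewrite big_seq1 mul1r /natpowC /= mulNr mulrC mulNr.
Qed.

Lemma derivable_expC (l z : C) : derivable (fun z : C => expC (l * z) : C) z (1 : C).
Proof.
have [K K0 hK] := expC_taylor 2.
apply/cvg_ex; exists (l * expC (l * z)).
apply/cvgrPdist_lt => e e0; near=> h.
have h0 : h != 0 by near: h; exact: nbhs_dnbhs_neq.
have n0 : 0 < `|h| by rewrite normr_gt0.
have l0 : 0 < `|l| + 1 by rewrite ltr_wpDl.
have lh1 : `|l * h| <= 1.
  rewrite normrM (@le_trans _ _ ((`|l| + 1) * `|h|))//.
    by rewrite ler_wpM2r// lerDl.
  rewrite -ler_pdivlMl// mulr1; near: h.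
  by apply: dnbhs0_le; rewrite invr_gt0.
have -> : l * expC (l * z) - h^-1 *: (expC (l * (h *: 1 + z)) - expC (l * z)) =
  - (expC (l * z) * h^-1 * (expC (l * h) - \sum_(i < 2) (l * h) ^+ i / i`!%:R)).
  have -> : expC (l * (h *: 1 + z)) = expC (l * h) * expC (l * z).
    by rewrite -expCD -mulrDr -[h *: 1]/(h * 1) mulr1.
  rewrite -[_ *: _]/(_ * _) !big_ord_recl big_ord0 /=.
  rewrite /bump /= !addn0 !expr0 expr1 fact0 (_ : 1`! = 1)%N// !divr1 addr0.
  by field.
rewrite normrN 2!normrM normfV.
apply: (@le_lt_trans _ _ (`|expC (l * z)| * `|h|^-1 * (K * `|l * h| ^+ 2))).
  by rewrite ler_wpM2l// ?mulr_ge0 ?invr_ge0//; exact: hK.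
have -> : `|expC (l * z)| * `|h|^-1 * (K * `|l * h| ^+ 2) =
    `|expC (l * z)| * K * `|l| ^+ 2 * `|h|.
  rewrite (normrM l h); move: `|expC _| `|h| n0 => A x x0.
  by field; rewrite gt_eqF.
set A := _ * K * _.
have A0 : 0 <= A by rewrite !mulr_ge0 ?exprn_ge0.
apply: (@le_lt_trans _ _ ((A + 1) * `|h|)).
  by rewrite ler_wpM2r// lerDl.
have A1 : 0 < A + 1 by exact: ltr_wpDl.
rewrite -ltr_pdivlMl//; near: h.
apply: dnbhs0_lt; apply: mulr_gt0 => //.
by rewrite invr_gt0 ltr_wpDl// !mulr_ge0 ?exprn_ge0.
Unshelve. all: by end_near.
Qed.

Lemma exppoly_derivable f (z : C) : exppoly f -> derivable (f : C -> C) z (1 : C).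
Proof.
move=> [s hs]; have -> : f = \sum_(p <- s) (fun z => p.1 * expC (p.2 * z)).
  by apply/funext => x; rewrite hs fct_sumE.
rewrite {hs}; elim: s => [|p s IH].
  by rewrite big_nil; exact: derivable_cst.
rewrite big_cons.
have h := @derivableZ _ _ _ (fun z : C => expC (p.2 * z)) p.1 z 1 (@derivable_expC p.2 z).
exact: (@derivableD _ _ _ _ _ z 1 h IH).
Qed.

Lemma interpolation (F : fieldType) (s : seq F) (g : F -> F) :
  exists p : {poly F}, {in s, forall x, p.[x] = g x}.
Proof.
elim: s => [|a s [p hp]]; first by exists 0.
have [ais|ais] := boolP (a \in s).
  exists p => x; rewrite inE => /orP[/eqP->|xs]; exact: hp.
set q := \prod_(b <- s) ('X - b%:P).
have qa : q.[a] != 0 by rewrite -[_ == 0]/(root _ _) root_prod_XsubC.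
exists (p + ((g a - p.[a]) / q.[a])%:P * q) => x.
rewrite inE !hornerE => /orP[/eqP->|xs]; first by rewrite divfK// addrC subrK.
have /eqP -> : q.[x] == 0 by rewrite -[_ == 0]/(root _ _) root_prod_XsubC.
by rewrite mulr0 addr0 hp.
Qed.

(* If all moments [\sum_k d_k l_k ^ j] vanished, so would
   [\sum_k d_k p(l_k)] for every polynomial [p]; interpolating the
   exponentials at the [l_k] would then kill [f]. *)
Lemma moment_neq0 (s : seq (C * C)) (z0 z1 : C) :
  \sum_(p <- s) p.1 * expC (p.2 * z1) != 0 ->
  exists j, \sum_(p <- s) p.1 * expC (p.2 * z0) * p.2 ^+ j != 0.
Proof.
move=> h; apply: contrapT => /forallNP H.
have [q hq] := interpolation [seq p.2 | p <- s] (fun l => expC (l * (z1 - z0))).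
move/eqP: h; apply.
have -> : \sum_(p <- s) p.1 * expC (p.2 * z1) =
    \sum_(p <- s) p.1 * expC (p.2 * z0) * q.[p.2].
  rewrite big_seq [RHS]big_seq; apply: eq_bigr => p ps.
  rewrite hq ?map_f// -mulrA -expCD -mulrDr.
  by congr (_ * expC (_ * _)); ring.
under eq_bigr do rewrite horner_coef mulr_sumr.
rewrite exchange_big big1// => i _.
under eq_bigr do rewrite mulrCA.
rewrite -mulr_sumr.
by have /negP/negPn/eqP -> := H i; rewrite mulr0.
Qed.

Lemma near_dist_lt (z0 e : C) : 0 < e -> \forall z \near z0, `|z0 - z| < e.
Proof.
exact: (@pseudometric_normed_Zmodule.cvgr_dist_lt _ _ _ _ (nbhs_filter z0) id).
Qed.

Lemma near_dist_le (z0 e : C) : 0 < e -> \forall z \near z0, `|z0 - z| <= e.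
Proof. by move=> /near_dist_lt-/(_ z0); apply: filterS => z /ltW. Qed.

(** The least [j] with a nonzero moment [M] is the order of vanishing at [z0]: f(z0 + h) is M / j! *
    h^j up to an error B |h|^(j+1), which is too small to cancel the leading term on a small
    punctured disc. The point [z1] certifies that [f] is not identically zero. *)
Lemma exppoly_isolated f (z0 z1 : C) : exppoly f -> f z1 != 0 ->
  \forall z \near z0^', f z != 0.
Proof.
move=> [s fs]; rewrite fs => /(moment_neq0 z0) ex_j.
have [j Mj minj] := ex_minnP ex_j.
set M := \sum_(p <- s) _ in Mj.
have [K K0 hK] := expC_taylor j.+1.
pose L := \sum_(p <- s) `|p.2|.
pose B := \sum_(p <- s) `|p.1 * expC (p.2 * z0)| * K * `|p.2| ^+ j.+1.
have L0 : 0 <= L by apply: sumr_ge0.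
have L1 : 0 < L + 1 by exact: ltr_wpDl.
have B0 : 0 <= B by apply: sumr_ge0 => p _; rewrite !mulr_ge0 ?exprn_ge0.
have B1 : 0 < B + 1 by exact: ltr_wpDl.
have fj : 0 < (j`!%:R : C) by rewrite ltr0n fact_gt0.
near=> z.
pose h := z - z0.
have h0 : h != 0 by rewrite subr_eq0; near: z; exact: nbhs_dnbhs_neq.
have hn : 0 < `|h| by rewrite normr_gt0.
have hL p : p \in s -> `|p.2 * h| <= 1.
  move=> ps; rewrite normrM (@le_trans _ _ ((L + 1) * `|h|))//.
    rewrite ler_wpM2r//; rewrite /L (big_rem p)//= -addrA lerDl.
    by rewrite addr_ge0// sumr_ge0.
  rewrite -ler_pdivlMl// mulr1 /h distrC; near: z.
  by apply: nbhs_dnbhs; apply: near_dist_le; rewrite invr_gt0.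
have hB : `|h| * (B + 1) < `|M| / j`!%:R.
  rewrite -ltr_pdivlMr// /h distrC; near: z.
  apply: nbhs_dnbhs; apply: near_dist_lt;
  by rewrite !divr_gt0 ?normr_gt0.
have fz : f z = M / j`!%:R * h ^+ j + \sum_(p <- s) p.1 * expC (p.2 * z0) *
   (expC (p.2 * h) - \sum_(i < j.+1) (p.2 * h) ^+ i / i`!%:R).
  rewrite fs; under [in RHS]eq_bigr do rewrite mulrBr.
  rewrite sumrB addrCA.
  have -> : \sum_(p <- s) p.1 * expC (p.2 * z0) *
      (\sum_(i < j.+1) (p.2 * h) ^+ i / i`!%:R) = M / j`!%:R * h ^+ j.
    under eq_bigr do rewrite mulr_sumr.
    rewrite exchange_big big_ord_recr /= big1 ?add0r.
      rewrite /M !mulr_suml; apply: eq_bigr => p _; rewrite exprMn; ring.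
    move=> i _.
    have -> : \sum_(p <- s) p.1 * expC (p.2 * z0) * ((p.2 * h) ^+ i / i`!%:R) =
       (\sum_(p <- s) p.1 * expC (p.2 * z0) * p.2 ^+ i) * (h ^+ i / i`!%:R).
      rewrite mulr_suml; apply: eq_bigr => p _; rewrite exprMn; ring.
    have [->|/minj] := eqVneq (\sum_(p <- s) p.1 * expC (p.2 * z0) * p.2 ^+ i) 0.
      by rewrite mul0r.
    by rewrite leqNgt ltn_ord.
  rewrite subrr addr0; apply: eq_bigr => p _.
  by rewrite -mulrA -expCD -mulrDr /h addrC subrK.
have hrest : `|\sum_(p <- s) p.1 * expC (p.2 * z0) *
   (expC (p.2 * h) - \sum_(i < j.+1) (p.2 * h) ^+ i / i`!%:R)| <= B * `|h| ^+ j.+1.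
  rewrite (le_trans (ler_norm_sum _ _ _))// /B mulr_suml.
  rewrite big_seq [leRHS]big_seq; apply: ler_sum => p ps.
  rewrite normrM -!mulrA ler_wpM2l//; apply: le_trans (hK _ (hL _ ps)) _.
  by rewrite normrM exprMn.
apply/eqP => fz0; move: fz; rewrite fz0 => /esym/eqP.
rewrite addr_eq0 => /eqP E.
have : `|M / j`!%:R * h ^+ j| <= B * `|h| ^+ j.+1 by rewrite E normrN.
rewrite normrM normf_div normrX (ger0_norm (ltW fj)) exprS [leRHS]mulrA.
rewrite ler_pM2r ?exprn_gt0// => /le_lt_trans /(_ _) H.
have /H : B * `|h| < `|M| / j`!%:R.
  by apply: le_lt_trans hB; rewrite mulrC ler_wpM2l// lerDl.
by rewrite ltxx.
Unshelve. all: by end_near.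
Qed.

Lemma exppoly_continuous f : exppoly f -> continuous (f : C -> C).
Proof.
move=> hf z; apply: differentiable_continuous; apply/derivable1_diffP.
exact: exppoly_derivable.
Qed.

End ExpPoly.

(** * Sums over paths and the transfer operator *)

Section GradedSum.
Variable R : realType.
Local Notation C := (R[i]).

Lemma ler_sum_uniq_sub (I : eqType) (D : numDomainType) (s t : seq I) (F : I -> D) :
  uniq s -> uniq t -> {subset s <= t} -> (forall i, 0 <= F i) ->
  \sum_(i <- s) F i <= \sum_(i <- t) F i.
Proof.
move=> us ut st F0; rewrite [leRHS](bigID (mem s)) /=.
have -> : \sum_(i <- t | i \in s) F i = \sum_(i <- s) F i.
  rewrite -big_filter; apply: perm_big; apply: uniq_perm => //.
    by rewrite filter_uniq.
  by move=> i; rewrite mem_filter; apply: andb_idr => /st.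
by rewrite lerDl sumr_ge0.
Qed.

(** Unconditional summation runs over finite sets of paths, whereas the transfer operator sums by
    length. Once a finite set contains everything of degree below [N], what it adds beyond is
    bounded by a geometric tail that does not depend on the set. *)
Lemma has_sum_graded (I : choiceType) (P : pred I) (f : I -> C)
    (A : nat -> seq I) (deg : I -> nat) (K theta : R) (S : C) :
  (forall n, uniq (A n)) -> (forall n i, i \in A n -> deg i = n) ->
  (forall i, P i -> i \in A (deg i)) ->
  0 <= K -> 0 <= theta -> theta < 1 ->
  (forall n, \sum_(i <- A n | P i) `|f i| <= (K * theta ^+ n)%:C%C) ->
  (fun N => \sum_(n < N) \sum_(i <- A n | P i) f i) @ \oo --> S ->
  has_sum P f S.
Proof.
move=> uA degA PA K0 th0 th1 bA cS; rewrite /has_sum.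
have FF := @summability.totally_filter I.
set g := fun i => _.
pose L N M := flatten [seq A n | n <- index_iota N M].
have memL N M i : (i \in L N M) -> i \in A (deg i) /\ (N <= deg i < M)%N.
  move=> /flattenP[s /mapP[n nNM ->] iA]; rewrite (degA _ _ iA); split=> //.
  by rewrite -mem_index_iota.
have Lmem N M i : i \in A (deg i) -> (N <= deg i < M)%N -> i \in L N M.
  move=> iA dNM; apply/flattenP; exists (A (deg i)) => //.
  by apply/mapP; exists (deg i); rewrite ?mem_index_iota.
have uL N M : uniq (L N M).
  have uNM : uniq (index_iota N M) by exact: iota_uniq.
  rewrite /L; elim: (index_iota N M) uNM => //= n s IH /andP[ns us].
  rewrite cat_uniq uA IH// andbT /=; apply/hasPn => i /flattenP[t /mapP[m ms ->] im].
  by apply/negP => iin; move: ns; rewrite -(degA _ _ iin) (degA _ _ im) ms.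
have sumL (F : I -> C) N M : \sum_(i <- L N M | P i) F i =
    \sum_(N <= n < M) \sum_(i <- A n | P i) F i.
  by rewrite big_flatten big_map.
apply/cvgrPdist_le => e e0.
have th1' : `|theta| < 1 by rewrite ger0_norm.
have [er er0 eE] : exists2 er : R, 0 < er & e = er%:C%C.
  have /RRe_real er : e \is Num.real by exact: gtr0_real.
  by exists (complex.Re e) => //; rewrite -ltcR er.
have h1 : \forall N \near \oo, `|S - \sum_(n < N) \sum_(i <- A n | P i) f i| <= (er / 2)%:C%C.
  by apply: pseudometric_normed_Zmodule.cvgr_dist_le cS _ _; rewrite ltcR divr_gt0.
have h2 : \forall N \near \oo, geometric (K / (1 - theta)) theta N <= er / 2.
  have H := pseudometric_normed_Zmodule.cvgr_dist_le _ _
    (@cvg_geometric R (K / (1 - theta)) theta th1') (er / 2) (divr_gt0 er0 (ltr0Sn _ 1)).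
  apply: filterS (H _) => N; rewrite sub0r normrN.
  exact: le_trans (ler_norm _).
have [N [hS hT]] : exists N, `|S - \sum_(n < N) \sum_(i <- A n | P i) f i| <= (er / 2)%:C%C
    /\ geometric (K / (1 - theta)) theta N <= er / 2.
  by have [N []] := filter_ex (filterI h1 h2); exists N.
exists [fset i in L 0 N]%fset => // J /= /fsubsetP LJ.
have -> : summability.partial_sum g J = \sum_(i <- J | P i) f i.
  by rewrite [RHS]big_mkcond big_seq_fsetE.
rewrite (bigID (fun i => deg i < N)%N) /=.
have -> : \sum_(i <- J | P i && (deg i < N)%N) f i =
    \sum_(n < N) \sum_(i <- A n | P i) f i.
  rewrite -(big_mkord xpredT (fun n => \sum_(i <- A n | P i) f i)) -sumL.
  rewrite -big_filter -[RHS]big_filter; apply: perm_big; apply: uniq_perm.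
  - by rewrite filter_uniq.
  - by rewrite filter_uniq.
  move=> i; rewrite !mem_filter; case: (boolP (P i)) => //= Pi.
  apply/andP/idP => [[dN iJ]|iL].
    by apply: Lmem; [exact: PA|rewrite dN].
  have [_ /andP[_ dN]] := memL _ _ _ iL; split=> //.
  by apply: LJ; rewrite in_fset.
rewrite opprD addrA; apply: le_trans (ler_normB _ _) _.
rewrite eE [er]splitr rmorphD; apply: lerD => //.
apply: le_trans (ler_norm_sum _ _ _) _.
(* [M] exceeds every degree occurring in [J], so the rest of [J] lies in the finitely many degrees
   from [N] to [M - 1]. *)
pose M := (N + (\max_(i <- J) deg i).+1)%N.
apply: (@le_trans _ _ (\sum_(i <- L N M | P i) `|f i|)).
  rewrite -big_filter -[leRHS]big_filter; apply: ler_sum_uniq_sub => //.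
  - by rewrite filter_uniq.
  - by rewrite filter_uniq.
  move=> i; rewrite !mem_filter -leqNgt => /andP[/andP[Pi Ni] iJ]; rewrite Pi /=.
  apply: Lmem; first exact: PA.
  rewrite Ni /= /M addnS ltnS (leq_trans _ (leq_addl _ _))//.
  by rewrite (big_rem i)//= leq_maxl.
rewrite sumL.
apply: (@le_trans _ _ (\sum_(N <= n < M) (K * theta ^+ n))%:C%C).
  by rewrite rmorph_sum; apply: ler_sum.
rewrite lecR; apply: le_trans hT; rewrite /geometric /=.
rewrite -mulr_sumr -mulrA ler_wpM2l// mulrC.
have t0 : 0 < 1 - theta by rewrite subr_gt0.
rewrite ler_pdivlMr// -{1}[N]add0n big_addn /M addKn.
under eq_bigr do rewrite exprD.
rewrite -mulr_suml mulrAC big_mkord.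
have := subrX1 theta (\max_(i <- J) deg i).+1.
set s := \sum_(i < _) _ => E.
have -> : s * (1 - theta) = 1 - theta ^+ (\max_(i <- J) deg i).+1.
  by rewrite -[RHS]opprB E; ring.
by rewrite -[leRHS]mul1r ler_wpM2r ?exprn_ge0// gerBl exprn_ge0.
Qed.
End GradedSum.

Section NatPow.
Variable R : realType.
Local Notation C := (R[i]).

Lemma natpowC1 (s : C) : natpowC 1 s = 1.
Proof. by rewrite /natpowC ln1 rmorph0 mulr0 expC0. Qed.

Lemma natpowCM m n (s : C) : (0 < m)%N -> (0 < n)%N ->
  natpowC (m * n) s = natpowC m s * natpowC n s.
Proof.
move=> m0 n0; rewrite /natpowC natrM lnM ?posrE ?ltr0n//.
by rewrite rmorphD mulrDr expCD.
Qed.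

Lemma natpowC_at1 n : (0 < n)%N -> natpowC n (1 : C) = n%:R.
Proof.
move=> n0; rewrite /natpowC mul1r /expC /= cos0 sin0 lnK ?posrE ?ltr0n//.
by rewrite mulr1 rmorph_nat.
Qed.

Lemma norm_natpowC n (s : C) :
  `|natpowC n (- s)| = (expR (- (complex.Re s * ln n%:R)))%:C%C.
Proof.
rewrite /natpowC norm_expC; congr (expR _)%:C%C.
by case: s => a b /=; rewrite mulr0 subr0 mulNr.
Qed.

Lemma norm_natpowC_le1 n (s : C) : 0 <= complex.Re s -> (0 < n)%N ->
  `|natpowC n (- s)| <= 1.
Proof.
move=> s0 n0; rewrite norm_natpowC [leRHS](_ : 1 = (1 : R)%:C%C)// lecR.
rewrite -[leRHS]expR0 ler_expR oppr_le0.
by apply: mulr_ge0 => //; apply: ln_ge0; rewrite ler1n.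
Qed.

End NatPow.

Section Transfer.
Variables (R : realType) (V E : finType) (G : graph V E) (w : E -> nat).
Local Notation C := (R[i]).

(** The involution is a parameter because two are needed: edge inversion, which describes paths, and
    its modification on loops, which is invertible at s = -1. *)
Definition transfer (rho : E -> E) (s : C) (a b : E) : C :=
  if composable G a b then natpowC (w b - (b == rho a))%N (- s) else 0.

Definition kernel_app (M : E -> E -> C) (y : E -> C) (a : E) : C := \sum_b M a b * y b.

Fixpoint words n : seq (seq E) :=
  if n is m.+1 then [seq b :: l | b <- enum E, l <- words m] else [:: [::]].

Lemma mem_words n l : (l \in words n) = (size l == n).
Proof.
elim: n l => [|n IH] [|b l] //=.
  by apply/negbTE/negP => /allpairsP[[x y] [_ _]].
apply/allpairsP/idP => [[[x y] /= [_ yl [_ ->]]]|sl].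
  by rewrite eqSS -IH.
by exists (b, l); rewrite mem_enum IH -eqSS.
Qed.

Lemma uniq_words n : uniq (words n).
Proof.
elim: n => //= n IH; apply: allpairs_uniq => //; first exact: enum_uniq.
by move=> [a b] [c d] _ _ [-> ->].
Qed.

Section Rho.
Hypothesis w2 : forall a, (2 <= w a)%N.

Lemma weight_gt0 b (e : bool) : (0 < w b - e)%N.
Proof. by rewrite subn_gt0; apply: leq_trans (w2 b); case: e. Qed.

Lemma N_edg_gt0 a l : (0 < N_edg G w (inr (a, l)))%N.
Proof.
rewrite /=; elim: l a => [|b l IH] a /=; first by rewrite big_nil.
by rewrite big_cons muln_gt0 weight_gt0 IH.
Qed.

(** Each factor of [N_edg] becomes one matrix entry, since [n ^ (-s)] is multiplicative in positive
    [n]; peeling off the first edge is one application of the operator. *)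
Lemma sum_words s n a (y : E -> C) :
  \sum_(l <- words n | path (composable G) a l)
     natpowC (N_edg G w (inr (a, l))) (- s) * y (last a l) =
  iter n (kernel_app (transfer (einv G) s)) y a.
Proof.
elim: n a => [|n IH] a.
  by rewrite /= big_cons big_nil addr0 /= big_nil natpowC1 mul1r.
rewrite [words _]/= [iter _ _ _]/= big_mkcond big_allpairs_dep /kernel_app big_enum /=.
apply: eq_bigr => b _; rewrite -IH /transfer.
case: ifP => [ab|nab]; last first.
  by rewrite mul0r big1// => l _; rewrite nab.
rewrite mulr_sumr [RHS]big_mkcond; apply: eq_bigr => l _ /=.
case: ifP => // _; rewrite big_cons natpowCM ?weight_gt0 ?mulrA//.
exact: N_edg_gt0.
Qed.

Variables (rho : E -> E) (rhoK : involutive rho).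
Hypothesis w3 : forall a, (3 <= w a)%N \/ (3 <= w (rho a))%N.

(* The only entries of the transfer matrix equal to 1 in absolute value are
   those at (a, rho a) with w (rho a) = 2, and then w a >= 3. *)
Definition backtrack_weight a : C := if w (rho a) == 2 then 2 else 1.

Lemma hweight_ge1 a : 1 <= backtrack_weight a.
Proof. by rewrite /backtrack_weight; case: ifP => // _; rewrite ler1n. Qed.

Lemma hweight_le2 a : backtrack_weight a <= 2.
Proof. by rewrite /backtrack_weight; case: ifP => // _; rewrite ler1n. Qed.

(** A row containing an entry of base 1 has weight 2, while the edge reached by that entry has
    weight 1, so the weighted sum is at most 1 + 1/2 = 3/4 * 2. In every other row all bases are at
    least 2 and the sum is at most 1/2. *)
Lemma transfer_hweight : exists2 sigma : R, 0 <= sigma & forall s : C,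
  sigma < complex.Re s ->
  forall a, \sum_b `|transfer rho s a b| * backtrack_weight b <= 3 / 4 * backtrack_weight a.
Proof.
(* An entry of base at least 2 drops below 1/q once 2^(Re s) > q, whence the abscissa ln q / ln 2.
   At most [#|E|] such entries, each of weight at most 2, then sum to at most 1/2. *)
pose q : R := 4 * #|E|.+1%:R.
have q1 : 1 <= q.
  by rewrite /q -natrM ler1n muln_gt0.
have q0 : 0 < q by exact: lt_le_trans q1.
have ln2 : 0 < ln (2 : R) by rewrite ln_gt0// ltr1n.
exists (ln q / ln 2); first by apply: divr_ge0; [exact: ln_ge0|exact: ltW].
move=> s; rewrite ltr_pdivrMr// => sq a.
have s0 : 0 < complex.Re s.
  by move: (le_lt_trans (ln_ge0 q1) sq); rewrite pmulr_lgt0.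
pose m b := (w b - (b == rho a))%N.
have small b : (2 <= m b)%N -> `|transfer rho s a b| <= (q^-1)%:C%C.
  move=> mb; rewrite /transfer; case: ifP => _; last first.
    by rewrite normr0 ler0c invr_ge0 ltW.
  rewrite norm_natpowC lecR -[q]lnK ?posrE// -expRN ler_expR lerN2.
  apply: le_trans (ltW sq) _; rewrite ler_wpM2l// ?(ltW s0)//.
  by rewrite ler_ln ?posrE ?ltr0n ?ler_nat// (leq_trans _ mb).
have le1 b : `|transfer rho s a b| <= 1.
  rewrite /transfer; case: ifP => _; last by rewrite normr0.
  by rewrite norm_natpowC_le1 ?weight_gt0// ltW.
have tail (P : pred E) : (forall b, P b -> (2 <= m b)%N) ->
    \sum_(b | P b) `|transfer rho s a b| * backtrack_weight b <= (2^-1)%:C%C.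
  move=> Pm; apply: (@le_trans _ _ (\sum_(b | P b) (q^-1)%:C%C * 2)).
    apply: ler_sum => b /Pm/small mb.
    by rewrite ler_pM ?hweight_le2// (le_trans ler01)// hweight_ge1.
  apply: (@le_trans _ _ (\sum_(b : E) (q^-1)%:C%C * 2)).
    rewrite [leRHS](bigID P) /= lerDl sumr_ge0// => b _.
    by rewrite mulr_ge0// ler0c invr_ge0 ltW.
  have -> : \sum_(b : E) (q^-1)%:C%C * 2 = (#|E|%:R * (q^-1 * 2))%:C%C :> C.
    rewrite sumr_const -[LHS]mulr_natl [RHS]rmorphM [X in _ = _ * X]rmorphM.
    by rewrite !rmorph_nat; congr (_%:R * _); exact: eq_card.
  have card : #|E|%:R <= #|E|.+1%:R :> R by rewrite ler_nat.
  rewrite lecR mulrCA ler_pdivrMl// /q; lra.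
have [w2a|w2a] := eqVneq (w (rho a)) 2.
  have -> : backtrack_weight a = 2 by rewrite /backtrack_weight w2a.
  have hr : backtrack_weight (rho a) = 1.
    rewrite /backtrack_weight rhoK; case: eqP => // wa.
    by case: (w3 a); rewrite ?wa ?w2a.
  rewrite (bigD1 (rho a)) //= hr mulr1.
  apply: (@le_trans _ _ (1 + (2^-1)%:C%C)).
    apply: lerD => //; apply: tail => b bra; rewrite /m (negbTE bra) subn0 //.
  have -> : (1 : C) + (2^-1)%:C%C = (1 + 2^-1)%:C%C by rewrite rmorphD.
  have -> : (3 / 4 * 2 : C) = (3 / 4 * 2)%:C%C by rewrite !rmorphM fmorphV !rmorph_nat.
  by rewrite lecR; lra.
have -> : backtrack_weight a = 1 by rewrite /backtrack_weight (negbTE w2a).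
rewrite mulr1; apply: le_trans (tail _ _) _.
  move=> b _; rewrite /m; case: eqP => [->|_]; last by rewrite subn0.
  by have := w2 (rho a); rewrite leq_eqVlt eq_sym (negbTE w2a) /=; lia.
have -> : (3 / 4 : C) = (3 / 4)%:C%C by rewrite !rmorphM fmorphV !rmorph_nat.
by rewrite lecR; lra.
Qed.

End Rho.
End Transfer.

Section PathSums.
Variables (R : realType) (V E : finType) (G : graph V E) (w : E -> nat).
Local Notation C := (R[i]).
Variables (rho : E -> E) (s : C).
Let M := transfer G w rho s.
Let h := backtrack_weight R w rho.
Hypothesis hM : forall a, \sum_b `|M a b| * h b <= 3 / 4 * h a.

Lemma norm_iter_app (z : E -> C) (c : C) n a :
  0 <= c -> (forall a, `|z a| <= c * h a) ->
  `|iter n (kernel_app M) z a| <= c * (3 / 4) ^+ n * h a.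
Proof.
move=> c0 zc; elim: n a => [|n IH] a; first by rewrite expr0 mulr1.
rewrite iterS {1}/kernel_app (le_trans (ler_norm_sum _ _ _))//.
apply: (@le_trans _ _ (c * (3 / 4) ^+ n * \sum_b `|M a b| * h b)).
  rewrite mulr_sumr; apply: ler_sum => b _.
  by rewrite normrM mulrCA ler_wpM2l.
have -> : c * (3 / 4) ^+ n.+1 * h a = c * (3 / 4) ^+ n * (3 / 4 * h a).
  by rewrite exprSr !mulrA.
by rewrite ler_wpM2l// mulr_ge0// exprn_ge0// divr_ge0.
Qed.

(** Iterating the equation shows that [x] minus the partial sum is the N-th iterate applied to [x]
    itself, which tends to 0 by contraction. Any solution is therefore the Neumann series, which
    also gives uniqueness. *)
Lemma neumann_cvg (x y : E -> C) : (forall a, x a = y a + kernel_app M x a) ->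
  forall a, (fun N => \sum_(n < N) iter n (kernel_app M) y a) @ \oo --> x a.
Proof.
move=> xE a.
have E1 N b : x b = \sum_(n < N) iter n (kernel_app M) y b + iter N (kernel_app M) x b.
  elim: N b => [|N IH] b; first by rewrite big_ord0 add0r.
  rewrite big_ord_recr /= IH -addrA; congr (_ + _).
  elim: {IH} N b => [|N IH] b /=; first exact: xE.
  rewrite /kernel_app -big_split; apply: eq_bigr => i _ /=.
  by rewrite -mulrDr -IH.
pose c := \sum_b `|x b|.
have c0 : 0 <= c by apply: sumr_ge0.
have xc b : `|x b| <= c * h b.
  rewrite (@le_trans _ _ c)//; first by rewrite /c (bigD1 b)//= lerDl sumr_ge0.
  by rewrite -[leLHS]mulr1 ler_wpM2l// hweight_ge1.
apply/cvgrPdist_le => e e0.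
have ch : 0 <= c * h a by rewrite mulr_ge0// (le_trans ler01)// hweight_ge1.
pose k : R := complex.Re (c * h a).
have kE : c * h a = k%:C%C by rewrite RRe_real// ger0_real.
have eE : e = (complex.Re e)%:C%C by rewrite RRe_real// gtr0_real.
have th : `|3 / 4 : R| < 1 by rewrite ger0_norm; lra.
have er0 : 0 < complex.Re e by rewrite -ltcR -eE.
have H := pseudometric_normed_Zmodule.cvgr_dist_le _ _
    (@cvg_geometric R k (3 / 4) th) _ er0.
apply: filterS (H _) => N; rewrite sub0r normrN /= => kN.
rewrite {1}(E1 N a) addrAC subrr add0r.
apply: le_trans (norm_iter_app _ _ c0 xc) _.
rewrite mulrAC kE eE.
have -> : k%:C%C * (3 / 4) ^+ N = (k * (3 / 4) ^+ N)%:C%C.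
  by rewrite [RHS]rmorphM [X in _ = _ * X]rmorphXn fmorph_div !rmorph_nat.
by rewrite lecR (le_trans _ kN)// ler_norm.
Qed.
End PathSums.

Section PathHasSum.
Variables (R : realType) (V E : finType) (G : graph V E) (w : E -> nat).
Local Notation C := (R[i]).
Hypothesis w2 : forall a, (2 <= w a)%N.
Variables (s : C).
Let M (s : C) := transfer G w (einv G) s.
Let h := backtrack_weight R w (einv G).
Hypothesis hM : forall s' : C, complex.Re s' = complex.Re s ->
  forall a, \sum_b `|M s' a b| * h b <= 3 / 4 * h a.

(** Absolute values of the terms at [s] are the terms at the real point Re s. Absolute convergence
    is thus the contraction at that point, which is why [hM] covers every exponent with the same
    real part. *)
Lemma norm_natpowC_real n (z : C) :
  `|natpowC n (- z)| = natpowC n (- (complex.Re z)%:C%C).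
Proof.
rewrite norm_natpowC /natpowC -rmorphN -rmorphM /expC /= cos0 sin0.
by rewrite mulr1 mulNr.
Qed.

Definition paths_of_length n : seq (gpath V E) :=
  if n is m.+1 then [seq inr (a, l) | a <- enum E, l <- words E m]
  else [seq inl v | v <- enum V].

(** Common form of both zeta series: [alpha] is the extra factor of the first edge, [S] and [T]
    select the first and the last edge, and [flag] discards the paths of length 1, whose
    contribution [T a] is then subtracted from [x a]. Trivial paths enter through the sum over
    vertices. *)
Lemma has_sum_paths (P : pred (gpath V E)) (f : gpath V E -> C)
    (alpha x : E -> C) (S T : pred E) (flag : bool) :
  (forall a l, f (inr (a, l)) = alpha a * natpowC (N_edg G w (inr (a, l))) (- s)) ->
  (forall a, `|alpha a| <= 1) ->
  (forall a l, P (inr (a, l)) =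
    [&& S a, path (composable G) a l, T (last a l) & flag ==> (0 < size l)%N]) ->
  (forall a, x a = (T a)%:R + kernel_app (M s) x a) ->
  has_sum P f (\sum_(v | P (inl v)) f (inl v) +
    \sum_(a | S a) alpha a * (x a - (T a)%:R *+ flag)).
Proof.
move=> fE alpha1 PE xE.
pose y a : C := (T a)%:R.
pose c0 : C := \sum_(v | P (inl v)) `|f (inl v)|.
have c00 : 0 <= c0 by apply: sumr_ge0.
have c0E : c0 = (complex.Re c0)%:C%C by rewrite RRe_real// ger0_real.
have sum0 (F : gpath V E -> C) :
    \sum_(i <- paths_of_length 0 | P i) F i = \sum_(v | P (inl v)) F (inl v).
  by rewrite /= big_map big_enum_cond.
have sumS (F : gpath V E -> C) n :
    \sum_(i <- paths_of_length n.+1 | P i) F i =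
    \sum_(a | S a) \sum_(l <- words E n | path (composable G) a l)
       (if flag && (n == 0)%N then 0 else F (inr (a, l)) * y (last a l)).
  rewrite /= big_mkcond big_allpairs_dep big_enum /= [RHS]big_mkcond.
  apply: eq_bigr => a _; case: (boolP (S a)) => Sa; last first.
    by rewrite big1// => l _; rewrite PE (negbTE Sa).
  rewrite [RHS]big_mkcond big_seq [RHS]big_seq; apply: eq_bigr => l.
  rewrite mem_words PE Sa /= => /eqP <-.
  case: (path _ _ _) => //=; rewrite /y; case: (T _) => /=.
    by case: (flag) => //=; rewrite ?mulr1//; case: (size l); rewrite ?mulr1.
  by rewrite mulr0 if_same.
have y1 a : `|y a| <= 1 * h a.
  rewrite mul1r (le_trans _ (hweight_ge1 _ _ _ _))// /y normr_nat.
  by case: (T a) => //=; rewrite ler01.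
have Re_r : complex.Re (complex.Re s)%:C%C = complex.Re s by [].
have nat0 a l : 0 <= natpowC (N_edg G w (inr (a, l))) (- (complex.Re s)%:C%C).
  by rewrite -norm_natpowC_real.
have y0 a : 0 <= y a by rewrite /y ler0n.
have wsum n a : \sum_(l <- words E n | path (composable G) a l)
    natpowC (N_edg G w (inr (a, l))) (- (complex.Re s)%:C%C) * y (last a l)
   <= (3 / 4) ^+ n * 2.
  rewrite -[leLHS]ger0_norm; last by apply: sumr_ge0 => l _; rewrite mulr_ge0.
  rewrite sum_words//.
  have := norm_iter_app (hM Re_r) n a ler01 y1.
  rewrite mul1r => /le_trans; apply.
  by rewrite ler_wpM2l ?hweight_le2// exprn_ge0// divr_ge0.
(* Length 0 contributes [c0]. Length n + 1 contributes at most 2 * (3/4)^n per initial edge, which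
   is below 3 * (3/4)^(n+1). *)
have [K K0 KE] : exists2 K : R, 0 <= K & K%:C%C = c0 + #|E|%:R * 3.
  exists (complex.Re c0 + #|E|%:R * 3).
    by rewrite addr_ge0 ?mulr_ge0 ?ler0n//; move: c00; rewrite c0E ler0c.
  by rewrite [in RHS]c0E rmorphD rmorphM !rmorph_nat.
apply: (@has_sum_graded _ _ _ _ paths_of_length (@glength V E) K (3 / 4)).
- case=> [|n] /=; first by rewrite map_inj_uniq ?enum_uniq// => ? ? [].
  apply: allpairs_uniq; [exact: enum_uniq|exact: uniq_words|].
  by move=> [? ?] [? ?] _ _ [-> ->].
- case=> [|n] i /=; first by move=> /mapP[v _ ->].
  by move=> /allpairsP[[a l] /= [_ + ->]]; rewrite mem_words => /eqP <-.
- case=> [v|[a l]] _ /=; first by rewrite map_f// mem_enum.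
  by apply/allpairsP; exists (a, l); rewrite mem_enum mem_words.
- exact: K0.
- by rewrite divr_ge0.
- lra.
- move=> n; rewrite rmorphM rmorphXn fmorph_div !rmorph_nat [X in X * _]KE.
  case: n => [|n]; first by rewrite sum0 expr0 mulr1 lerDl mulr_ge0.
  rewrite (sumS (fun i => `|f i|)).
  apply: (@le_trans _ _ (\sum_(a : E) (3 / 4) ^+ n * 2)).
    apply: (@le_trans _ _ (\sum_(a | S a) (3 / 4) ^+ n * 2)).
      apply: ler_sum => a _; apply: le_trans (wsum n a); apply: ler_sum => l _.
      case: ifP => _; first by rewrite mulr_ge0.
      rewrite fE normrM norm_natpowC_real ler_wpM2r// -[leRHS]mul1r.
      by rewrite ler_wpM2r.
    rewrite [leRHS](bigID S) /= lerDl; apply: sumr_ge0 => a _.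
    by rewrite mulr_ge0// exprn_ge0// divr_ge0.
  have -> : \sum_(a : E) (3 / 4) ^+ n * 2 = #|E|%:R * ((3 / 4) ^+ n * 2) :> C.
    by rewrite sumr_const -[LHS]mulr_natl; congr (_%:R * _); exact: eq_card.
  have p0 : 0 <= (3 / 4 : C) ^+ n by rewrite exprn_ge0// divr_ge0.
  rewrite exprSr [leRHS]mulrDl.
  apply: (@le_trans _ _ (#|E|%:R * 3 * ((3 / 4) ^+ n * (3 / 4)))); last first.
    by rewrite lerDr mulr_ge0// mulr_ge0// divr_ge0.
  rewrite -!mulrA ler_wpM2l// [leRHS]mulrCA ler_wpM2l//.
  have -> : (3 * (3 / 4) : C) = 2 + 4^-1 by field.
  by rewrite lerDl invr_ge0.
(* A path of length n + 1 is an initial edge followed by a word of length n, hence the shift by one.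
   The term removed by [flag] is the summand n = 0, present as soon as N > 0. *)
rewrite -(cvg_shiftS (fun N => \sum_(n < N) \sum_(i <- paths_of_length n | P i) f i)).
rewrite /=.
have -> : (fun N => \sum_(n < N.+1) \sum_(i <- paths_of_length n | P i) f i) =
   (fun N => \sum_(v | P (inl v)) f (inl v) + \sum_(a | S a) alpha a *
     (\sum_(n < N) iter n (kernel_app (M s)) y a - y a *+ (flag && (0 < N)%N))).
  apply/funext => N; rewrite big_ord_recl sum0; congr (_ + _).
  under eq_bigr do rewrite sumS.
  rewrite exchange_big; apply: eq_bigr => a _.
  have termE n : \sum_(l <- words E n | path (composable G) a l)
       (if flag && (n == 0)%N then 0 else f (inr (a, l)) * y (last a l)) =
    alpha a * (if flag && (n == 0)%N then 0 else iter n (kernel_app (M s)) y a).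
    case: ifP => _; first by rewrite big1 ?mulr0.
    rewrite -sum_words// mulr_sumr; apply: eq_bigr => l _.
    by rewrite fE mulrA.
  under eq_bigr do rewrite termE.
  rewrite -mulr_sumr; congr (_ * _).
  case: N => [|N]; first by rewrite !big_ord0 andbF subr0.
  rewrite !big_ord_recl /= andbT; case: (flag) => /=.
    by rewrite add0r addrAC subrr add0r.
  by rewrite subr0.
apply: cvgD; first exact: cvg_cst.
apply: cvg_big => [|a Sa]; first exact: add_continuous.
apply: cvgM; first exact: cvg_cst.
have H := neumann_cvg (@hM s erefl) xE (a := a).
apply: cvgB; first exact: H.
apply: cvg_near_cst; near=> N; congr (_ *+ _).
have -> : (0 < N)%N by near: N; exact: nbhs_infty_gt.
by rewrite andbT.
Unshelve. all: by end_near.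
Qed.
End PathHasSum.

(** * Reduced walks and automorphisms of the universal cover *)

Section Walks.
Variables (V E : choiceType) (G : graph V E).

Definition nonback : rel E := fun x y => y != einv G x.

(** If two edges have the same target, the segment after the first one up to and including the
    second is a shorter closed reduced path. Keeping the cycle inside the given edges lets
    properties of these edges pass to it. *)
Lemma closed_reduced_cycle a l :
  path (composable G) a l -> path nonback a l -> org G a = tgt G (last a l) ->
  exists2 c, is_cycle G c & {subset c <= a :: l}.
Proof.
have [n ] := ubnP (size l); elim: n a l => // n IH a l sl pl rl cl.
have [ul|/uniqPn] := boolP (uniq (map (tgt G) (a :: l))).
  by exists (a :: l) => //; rewrite /is_cycle pl rl cl eqxx.
move=> /(_ (tgt G a))[i [j [ij]]]; rewrite size_map => js.
rewrite !(nth_map a)//; last exact: ltn_trans js.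
set s := a :: l in js *; move=> E1.
pose m := drop i.+1 (take j.+1 s).
have sm : size m = (j - i)%N.
  by rewrite size_drop size_takel// subSS.
have cm : sorted (composable G) m by apply: drop_sorted; apply: take_sorted.
have rm : sorted nonback m by apply: drop_sorted; apply: take_sorted.
have nm k : (i.+1 + k < j.+1)%N -> nth a m k = nth a s (i.+1 + k).
  by move=> kj; rewrite nth_drop nth_take.
have mE : m = nth a m 0 :: behead m.
  by move: sm; case: (m) => //= sm; move: ij; rewrite -subn_gt0 -sm.
have lm : last (nth a m 0) (behead m) = nth a s j.
  rewrite (last_nth a) -mE size_behead sm nm; last by lia.
  by congr nth; lia.
have om : org G (nth a m 0) = tgt G (nth a s i).
  rewrite nm ?addn0; last by lia.
  have /(sortedP a)/(_ i) : sorted (composable G) s by [].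
  by rewrite (leq_ltn_trans ij js) /composable => /(_ isT)/eqP ->.
have [||||c cc sc] := IH (nth a m 0) (behead m).
- rewrite size_behead sm /=; move: js sl ij; rewrite /s /=; lia.
- by move: cm; rewrite {1}mE.
- by move: rm; rewrite {1}mE.
- by rewrite om lm.
exists c => // x /sc; rewrite -mE => /mem_drop /mem_take; exact.
Qed.

(** With the starting vertex given separately, the empty list is the trivial path and paths compose
    by concatenation of lists. *)
Fixpoint walk (u : V) (l : seq E) : bool :=
  if l is a :: l' then (org G a == u) && walk (tgt G a) l' else true.

Definition wend (u : V) (l : seq E) : V := last u (map (tgt G) l).

Definition winv (l : seq E) : seq E := rev (map (einv G) l).

Lemma tgt_einv a : tgt G (einv G a) = org G a.
Proof. by rewrite -org_einv einvK. Qed.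

Lemma walk_cat u l m : walk u (l ++ m) = walk u l && walk (wend u l) m.
Proof. by elim: l u => //= a l IH u; rewrite IH andbA. Qed.

Lemma wend_cat u l m : wend u (l ++ m) = wend (wend u l) m.
Proof. by rewrite /wend map_cat last_cat. Qed.

Lemma walk_rcons u l a : walk u (rcons l a) = walk u l && (org G a == wend u l).
Proof. by rewrite -cats1 walk_cat /= andbT. Qed.

Lemma wend_rcons u l a : wend u (rcons l a) = tgt G a.
Proof. by rewrite -cats1 wend_cat. Qed.

Lemma walk_inv u l : walk u l -> walk (wend u l) (winv l) /\ wend (wend u l) (winv l) = u.
Proof.
elim/last_ind: l u => //= l a IH u; rewrite walk_rcons => /andP[/IH[w1 w2]] /eqP oa.
rewrite wend_rcons /winv map_rcons rev_rcons /= org_einv eqxx /= tgt_einv oa.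
by split=> //; rewrite /wend /= tgt_einv oa; exact: w2.
Qed.

Lemma nonback_inv l : sorted nonback l -> sorted nonback (winv l).
Proof.
rewrite /winv rev_sorted sorted_map; apply: sub_sorted => x y.
by rewrite /relpre/= /nonback einvK; apply: contra => /eqP ->.
Qed.

Lemma walk_path a l : walk (org G a) (a :: l) = path (composable G) a l.
Proof.
rewrite /= eqxx /=; elim: l a => //= b l IH a.
by rewrite IH /composable eq_sym.
Qed.

Lemma wend_cons u a l : wend u (a :: l) = tgt G (last a l).
Proof. by rewrite /wend /= last_map. Qed.

Lemma walk_reduce u l : walk u l ->
  exists m, [/\ walk u m, sorted nonback m & wend u m = wend u l].
Proof.
elim: l u => [|a l IH] u; first by exists [::].
move=> /= /andP[/eqP oa /IH[m [wm rm em]]].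
case: m wm rm em => [|b m] wm rm em.
  by exists [:: a]; rewrite /= oa eqxx; split.
have [ba|ba] := eqVneq b (einv G a).
  move: wm; rewrite /= ba tgt_einv oa => /andP[_ wm]; exists m.
  split=> //; first exact: path_sorted rm.
  by move: em; rewrite /wend /= ba tgt_einv oa.
exists [:: a, b & m]; split; [|by rewrite /= {1}/nonback ba; exact: rm|exact: em].
by rewrite [walk _ _]/= oa eqxx.
Qed.

Lemma connected_walk : connected_graph G -> forall u v, exists l, walk u l /\ wend u l = v.
Proof.
move=> cG u v; have [[x|[a l]]] := cG u v; rewrite /paths_between /= !orbF.
  by move=> /andP[/eqP-> /eqP->]; exists [::].
move=> /and3P[pl /eqP oa /eqP ta]; exists (a :: l).
by rewrite -oa walk_path wend_cons.
Qed.

Hypothesis acyclic : forall c, ~~ is_cycle G c.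

Lemma reduced_closed_nil u l : walk u l -> sorted nonback l -> wend u l = u -> l = [::].
Proof.
case: l => // a l wl rl el.
have oa : org G a = u by move: wl => /= /andP[/eqP].
have [||c] := @closed_reduced_cycle a l _ rl; last by rewrite (negbTE (acyclic c)).
  by rewrite -walk_path oa.
by rewrite oa -{1}el wend_cons.
Qed.

(** After removal of the common initial edges, the inverse of one walk followed by the other is
    still reduced, and it is closed; in an acyclic graph it must be empty. *)
Lemma reduced_walk_unique u l m : walk u l -> walk u m ->
  sorted nonback l -> sorted nonback m -> wend u l = wend u m -> l = m.
Proof.
elim: l u m => [|a l IH] u [|b m] // wl wm rl rm e.
- by have := reduced_closed_nil wm rm (esym e).
- by have := reduced_closed_nil wl rl e.
have oa : org G a = u by move: wl => /= /andP[/eqP].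
have ob : org G b = u by move: wm => /= /andP[/eqP].
have [ab|ab] := eqVneq a b.
  rewrite -ab in wm rm e *; congr (_ :: _); apply: IH (tgt G a) _ _ _ _ _ _.
  - by case/andP: wl.
  - by case/andP: wm.
  - exact: path_sorted rl.
  - exact: path_sorted rm.
  - exact: e.
have [w1 w2] := walk_inv wl.
have /eqP : winv (a :: l) ++ b :: m = [::].
  apply: (@reduced_closed_nil (wend u (a :: l))).
  - by rewrite walk_cat w1 w2.
  - have := nonback_inv rl; rewrite /winv /= rev_cons.
    case: (rev (map (einv G) l)) => [|x s] /=; last first.
      rewrite cat_path last_rcons => -> /=; rewrite /nonback einvK eq_sym ab; exact: rm.
    by rewrite /nonback einvK eq_sym ab => _; exact: rm.
  - by rewrite wend_cat w2.
by rewrite -size_eq0 size_cat addnS.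
Qed.

End Walks.

Section Labels.
Variables (V E VT ET : choiceType) (G : graph V E) (w : E -> nat).
Variables (T : graph VT ET) (prj : ghom T G).
Hypothesis cover : is_universal_cover w prj.

(** Turns the cardinality condition of the cover into a numbering: [L] numbers the lifts of a base
    edge at each vertex, and [I] recovers the lift from its number. Matching numbers identifies the
    stars of any two vertices with the same image. *)
Lemma fiber_labels : exists (L : ET -> nat) (I : VT -> E -> nat -> ET),
  (forall v a i, homV prj v = org G a -> (i < w a)%N ->
     [/\ org T (I v a i) = v, homE prj (I v a i) = a & L (I v a i) = i]) /\
  (forall e, (L e < w (homE prj e))%N /\ I (org T e) (homE prj e) (L e) = e).
Proof.
have [_ prj_surj hc] := cover.
have H (va : VT * E) : exists fg : (ET -> nat) * (nat -> ET),
    homV prj va.1 = org G va.2 ->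
    (forall i, (i < w va.2)%N -> [/\ org T (fg.2 i) = va.1,
       homE prj (fg.2 i) = va.2 & fg.1 (fg.2 i) = i]) /\
    (forall e, org T e = va.1 -> homE prj e = va.2 ->
       (fg.1 e < w va.2)%N /\ fg.2 (fg.1 e) = e).
  case: va => v a /=.
  have [[//|e0] _] := prj_surj (inr a).
  have [va|nva] := pselect (homV prj v = org G a); last first.
    by exists (fun=> 0%N, fun=> e0).
  have /card_set_bijP[f [fA fI fS]] := hc a v va.
  have /choice[g gP] : forall i : nat, exists e, (i < w a)%N ->
      [/\ org T e = v, homE prj e = a & f e = i].
    move=> i; have [iw|wi] := ltnP i (w a); last by exists e0.
    by have [e [ oe pe] fe] := fS i iw; exists e.
  exists (f, g) => _ /=; split=> // e oe pe.
  have fe : (f e < w a)%N by apply: fA.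
  split=> //; have [ og pg fg] := gP _ fe.
  by apply: fI => //; rewrite inE.
have [fg fgP] := choice H.
exists (fun e => (fg (org T e, homE prj e)).1 e), (fun v a => (fg (v, a)).2).
split=> [v a i va iw|e].
  have [h _] := fgP (v, a) va; have [ o1 p1 f1] := h i iw.
  by split; rewrite ?o1 ?p1.
have [_ h] := fgP (org T e, homE prj e) (hom_org prj e).
exact: h.
Qed.

End Labels.

Lemma sorted_rcons2 (A : Type) (e : rel A) (m : seq A) (g f : A) :
  sorted e (rcons (rcons m g) f) = sorted e (rcons m g) && e g f.
Proof. by case: m => [|x m] /=; rewrite ?andbT // !rcons_path last_rcons. Qed.

Section Extension.
Variables (V E VT ET : choiceType) (G : graph V E) (w : E -> nat).
Variables (T : graph VT ET) (prj : ghom T G).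
Hypothesis cover : is_universal_cover w prj.
Variables (L : ET -> nat) (I : VT -> E -> nat -> ET).
Hypothesis IP : forall v a i, homV prj v = org G a -> (i < w a)%N ->
     [/\ org T (I v a i) = v, homE prj (I v a i) = a & L (I v a i) = i].
Hypothesis LP : forall e, (L e < w (homE prj e))%N /\ I (org T e) (homE prj e) (L e) = e.

Definition label_move (v : VT) (f : ET) : ET := I v (homE prj f) (L f).

Lemma label_moveP v f : homV prj v = homV prj (org T f) ->
  [/\ org T (label_move v f) = v, homE prj (label_move v f) = homE prj f
    & label_move (org T f) (label_move v f) = f].
Proof.
move=> vf; have [lf If] := LP f.
have [] := IP (v := v) (a := homE prj f) _ lf; first by rewrite vf hom_org.
by rewrite -/(label_move v f) => o1 p1 l1; split=> //; rewrite /label_move p1 l1.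
Qed.

(* A label-preserving identification of the stars at [tgt p] and [tgt p'],
   corrected by a transposition so that the inverse of [p] goes to that
   of [p']. *)
Definition star_map (p p' f : ET) : ET :=
  if f == einv T p then einv T p' else
  if label_move (tgt T p') f == einv T p' then label_move (tgt T p') (einv T p)
  else label_move (tgt T p') f.

Lemma star_map_einv p p' : star_map p p' (einv T p) = einv T p'.
Proof. by rewrite /star_map eqxx. Qed.

Lemma star_mapP p p' f : homE prj p = homE prj p' -> org T f = tgt T p ->
  [/\ org T (star_map p p' f) = tgt T p', homE prj (star_map p p' f) = homE prj f
    & star_map p' p (star_map p p' f) = f].
Proof.
move=> pp of_.
have tt : homV prj (tgt T p') = homV prj (tgt T p) by rewrite !hom_tgt pp.
have op q : org T (einv T q) = tgt T q by exact: org_einv.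
have [ o1 p1 k1] : [/\ org T (label_move (tgt T p') f) = tgt T p',
     homE prj (label_move (tgt T p') f) = homE prj f
     & label_move (org T f) (label_move (tgt T p') f) = f].
  by apply: label_moveP; rewrite of_.
have [ o2 p2 k2] : [/\ org T (label_move (tgt T p') (einv T p)) = tgt T p',
     homE prj (label_move (tgt T p') (einv T p)) = homE prj (einv T p)
     & label_move (org T (einv T p)) (label_move (tgt T p') (einv T p)) = einv T p].
  by apply: label_moveP; rewrite op.
rewrite of_ in k1; rewrite op in k2.
have [->|fp] := eqVneq f (einv T p).
  by rewrite !star_map_einv !hom_einv pp op.
have [mf|mf] := eqVneq (label_move (tgt T p') f) (einv T p').
  have -> : star_map p p' f = label_move (tgt T p') (einv T p).
    by rewrite /star_map (negbTE fp) mf eqxx.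
  split=> //; first by rewrite p2 -p1 mf !hom_einv pp.
  rewrite /star_map; case: eqVneq => [m2|_].
    by move: k2; rewrite m2 -mf k1 => /eqP; rewrite (negbTE fp).
  by rewrite k2 eqxx -mf k1.
have -> : star_map p p' f = label_move (tgt T p') f.
  by rewrite /star_map (negbTE fp) (negbTE mf).
by split=> //; rewrite /star_map (negbTE mf) k1 (negbTE fp).
Qed.

(** The last matched pair of edges serves as the incoming pair of the next step, so backtracks go
    exactly to backtracks and reduced walks stay reduced. *)
Fixpoint walk_map (p p' : ET) (l : seq ET) : seq ET :=
  if l is f :: l' then star_map p p' f :: walk_map f (star_map p p' f) l' else [::].

Lemma walk_mapP p p' l : homE prj p = homE prj p' -> walk T (tgt T p) l ->
  [/\ walk T (tgt T p') (walk_map p p' l),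
      map (homE prj) (walk_map p p' l) = map (homE prj) l,
      walk_map p' p (walk_map p p' l) = l &
      sorted (nonback T) l -> sorted (nonback T) (walk_map p p' l)].
Proof.
elim: l p p' => [|f l IH] p p' //= pp /andP[/eqP of_ wl].
have [ o1 p1 k1] := star_mapP pp of_.
have [w1 m1 k2 s1] := IH f _ (esym p1) wl.
split.
- by rewrite o1 eqxx.
- by rewrite p1 m1.
- by rewrite k1 k2.
case: l wl w1 m1 k2 s1 {IH} => //= g l /andP[/eqP og wl] _ _ _ s1 /andP[gf rl].
rewrite s1// andbT; apply: contra gf => /eqP sg.
have [_ _ k3] := star_mapP (esym p1) og.
by rewrite -k3 sg star_map_einv.
Qed.

Lemma walk_map_rcons p p' l f : exists g,
  walk_map p p' (rcons l f) = rcons (walk_map p p' l) g.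
Proof.
elim: l p p' => [|a l IH] p p' /=; first by exists (star_map p p' f).
by have [g ->] := IH a (star_map p p' a); exists g.
Qed.

Let treeT : is_tree T. Proof. by case: cover. Qed.

Lemma geodesic_ex u v : exists l, [/\ walk T u l, sorted (nonback T) l & wend T u l = v].
Proof.
have [_ cT _] := treeT; have [l [wl <-]] := connected_walk cT u v.
exact: walk_reduce.
Qed.

Definition geodesic u v : seq ET := xget [::]
  [set l | [/\ walk T u l, sorted (nonback T) l & wend T u l = v]].

Lemma geodesicP u v : [/\ walk T u (geodesic u v),
  sorted (nonback T) (geodesic u v) & wend T u (geodesic u v) = v].
Proof.
rewrite /geodesic; case: xgetP => [l _ //|/(_ _)] H.
by have [l /H] := geodesic_ex u v.
Qed.

Lemma geodesicE u v l : walk T u l -> sorted (nonback T) l -> wend T u l = v ->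
  geodesic u v = l.
Proof.
move=> wl rl el; have [wg rg eg] := geodesicP u v; have [_ _ aT] := treeT.
by apply: (reduced_walk_unique aT wg wl rg rl); rewrite eg el.
Qed.

Definition away u f := geodesic u (tgt T f) == rcons (geodesic u (org T f)) f.

(** The geodesic from [u] to the origin of [f] either ends with the inverse of [f], and dropping
    this edge gives the geodesic to the target, or it can be prolonged by [f]. Hence each pair of
    inverse edges has one member pointing away from [u]. *)
Lemma awayN u f : away u (einv T f) = ~~ away u f.
Proof.
rewrite /away tgt_einv org_einv.
have [wo ro eo] := geodesicP u (org T f).
case/lastP E1 : (geodesic u (org T f)) => [|m g].
  have -> : geodesic u (tgt T f) = [:: f].
    by apply: geodesicE => //=; rewrite -eo E1 eqxx.
  by rewrite eqxx.
have tg : tgt T g = org T f by rewrite -eo E1 wend_rcons.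
have [wm og] : walk T u m /\ org T g = wend T u m.
  by move: wo; rewrite E1 walk_rcons => /andP[-> /eqP].
have rm : sorted (nonback T) m by move: ro; rewrite E1 -cats1 => /cat_sorted2[].
have [gf|gf] := eqVneq g (einv T f).
  have -> : geodesic u (tgt T f) = m.
    by apply: geodesicE => //; rewrite -og gf org_einv.
  rewrite gf eqxx /=; apply/esym/negP => /eqP /(congr1 size).
  by rewrite !size_rcons; lia.
have -> : geodesic u (tgt T f) = rcons (rcons m g) f.
  apply: geodesicE; rewrite ?wend_rcons//.
    by rewrite -E1 walk_rcons wo eo eqxx.
  rewrite sorted_rcons2 -E1 ro /=; apply: contra gf => /eqP ->.
  by rewrite einvK.
rewrite eqxx; apply/negP => /eqP /(congr1 size).
by rewrite !size_rcons; lia.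
Qed.

Lemma away_geodesic u f : away u f ->
  geodesic u (tgt T f) = rcons (geodesic u (org T f)) f.
Proof. by move/eqP. Qed.

(* [e |-> e'] extends to the tree by transporting geodesics: a vertex goes to
   the end of its transported geodesic, and an edge pointing away from the root
   to the last edge of its own. *)
Definition ext_walk (e e' : ET) (l : seq ET) := walk_map (einv T e) (einv T e') l.

Definition extV (e e' : ET) (v : VT) : VT :=
  wend T (org T e') (ext_walk e e' (geodesic (org T e) v)).

Definition extE_away (e e' f : ET) : ET :=
  last f (ext_walk e e' (rcons (geodesic (org T e) (org T f)) f)).

Definition extE (e e' f : ET) : ET :=
  if away (org T e) f then extE_away e e' f
  else einv T (extE_away e e' (einv T f)).

Section Ext.
Variables (e e' : ET) (ee : homE prj e = homE prj e').
Let eeN : homE prj (einv T e) = homE prj (einv T e').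
Proof. by rewrite !hom_einv ee. Qed.

Lemma ext_walkP l : walk T (org T e) l ->
  [/\ walk T (org T e') (ext_walk e e' l),
      map (homE prj) (ext_walk e e' l) = map (homE prj) l,
      ext_walk e' e (ext_walk e e' l) = l &
      sorted (nonback T) l -> sorted (nonback T) (ext_walk e e' l)].
Proof. by move=> wl; rewrite -!tgt_einv; apply: walk_mapP => //; rewrite tgt_einv. Qed.

Lemma geodesic_ext v : geodesic (org T e') (extV e e' v) =
  ext_walk e e' (geodesic (org T e) v).
Proof.
have [wg rg eg] := geodesicP (org T e) v; have [w1 _ _ r1] := ext_walkP wg.
by apply: geodesicE => //; exact: r1.
Qed.

Lemma extE_awayP f : away (org T e) f ->
  [/\ org T (extE_away e e' f) = extV e e' (org T f),
      tgt T (extE_away e e' f) = extV e e' (tgt T f),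
      homE prj (extE_away e e' f) = homE prj f &
      ext_walk e e' (geodesic (org T e) (tgt T f)) =
        rcons (ext_walk e e' (geodesic (org T e) (org T f))) (extE_away e e' f)].
Proof.
move=> /away_geodesic af.
have [wg rg eg] := geodesicP (org T e) (tgt T f).
have [w1 m1 _ r1] := ext_walkP wg.
have [g gE] := walk_map_rcons (einv T e) (einv T e') (geodesic (org T e) (org T f)) f.
have gf : extE_away e e' f = g by rewrite /extE_away /ext_walk gE last_rcons.
rewrite gf; move: w1 m1; rewrite /extV af /ext_walk gE wend_rcons.
rewrite walk_rcons => /andP[_ /eqP ->]; rewrite !map_rcons => /eqP.
by rewrite eqseq_rcons => /andP[_ /eqP ->].
Qed.

Lemma extE_einv f : extE e e' (einv T f) = einv T (extE e e' f).
Proof. by rewrite /extE awayN; case: (away _ f); rewrite /= ?einvK. Qed.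

Lemma ext_org f : extV e e' (org T f) = org T (extE e e' f).
Proof.
rewrite /extE; case: (boolP (away (org T e) f)) => [af|naf].
  by have [-> _ _ _] := extE_awayP af.
rewrite -awayN in naf; have [_ h _ _] := extE_awayP naf.
by rewrite org_einv h tgt_einv.
Qed.

Lemma extE_prj f : homE prj (extE e e' f) = homE prj f.
Proof.
rewrite /extE; case: (boolP (away (org T e) f)) => [af|naf].
  by have [_ _ -> _] := extE_awayP af.
rewrite -awayN in naf; have [_ _ h _] := extE_awayP naf.
by rewrite hom_einv h hom_einv einvK.
Qed.

Lemma extV_prj v : homV prj (extV e e' v) = homV prj v.
Proof.
have [wg _ eg] := geodesicP (org T e) v; have [w1 m1 _ _] := ext_walkP wg.
rewrite /extV -{2}eg; case/lastP: (geodesic (org T e) v) wg w1 m1 => [|l f] wl w1 m1.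
  by rewrite /wend /= !hom_org ee.
have [g gE] := walk_map_rcons (einv T e) (einv T e') l f.
move: m1; rewrite /ext_walk gE !wend_rcons !map_rcons => /eqP.
by rewrite eqseq_rcons !hom_tgt => /andP[_ /eqP ->].
Qed.

(** Transport starts at the origin of [e] with [einv T e] as the incoming edge; the transposition in
    [star_map] then forces its inverse [e] onto [e']. *)
Lemma extE_base : extE e e' e = e'.
Proof.
have g0 : geodesic (org T e) (org T e) = [::] by exact: geodesicE.
have ae : away (org T e) e.
  by rewrite /away g0; apply/eqP; apply: geodesicE; rewrite //= eqxx.
rewrite /extE ae /extE_away g0 /=.
by have := star_map_einv (einv T e) (einv T e'); rewrite !einvK.
Qed.

End Ext.

Lemma extK e e' v : homE prj e = homE prj e' -> extV e' e (extV e e' v) = v.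
Proof.
move=> ee; rewrite {1}/extV geodesic_ext//.
have [wg _ eg] := geodesicP (org T e) v.
by have [_ _ -> _] := ext_walkP ee wg.
Qed.

Lemma extEK e e' f : homE prj e = homE prj e' -> extE e' e (extE e e' f) = f.
Proof.
move=> ee.
have H g : away (org T e) g -> extE e' e (extE e e' g) = g.
  move=> ag; have [h1 h2 _ h4] := extE_awayP ee ag.
  have a' : away (org T e') (extE_away e e' g).
    by rewrite /away h1 h2 !geodesic_ext// h4.
  rewrite {2}/extE ag /extE a' /extE_away.
  rewrite h1 geodesic_ext// -/(extE_away e e' g) -h4.
  have [wg _ _] := geodesicP (org T e) (tgt T g).
  have [_ _ -> _] := ext_walkP ee wg.
  by rewrite (away_geodesic ag) last_rcons.
case: (boolP (away (org T e) f)) => [/H//|]; rewrite -awayN => /H h.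
by rewrite -[f](einvK T) extE_einv// extE_einv// h.
Qed.

Lemma edge_transitive e e' : homE prj e = homE prj e' ->
  exists g : aut_pi prj, act g (inr e) = inr e'.
Proof.
move=> ee.
pose g : ghom T T := GHom (ext_org ee) (@extE_einv e e').
pose g' : ghom T T := GHom (ext_org (esym ee)) (@extE_einv e' e).
have gK : cancel (hom_cell g) (hom_cell g').
  by case=> [v|f] /=; rewrite ?extK// extEK.
have g'K : cancel (hom_cell g') (hom_cell g).
  by case=> [v|f] /=; rewrite ?extK// extEK.
have gp x : hom_cell prj (hom_cell g x) = hom_cell prj x.
  by case: x => [v|f] /=; rewrite ?extV_prj// extE_prj.
exists (AutPi gK g'K gp).
by rewrite /act /= extE_base.
Qed.

End Extension.

(** * Haar measures of cell stabilisers *)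

Section HaarWeights.
Variables (R : realType) (V E : finType) (G : graph V E) (w : E -> nat).
Variables (VT ET : choiceType) (T : graph VT ET) (prj : ghom T G).
Hypothesis cover : is_universal_cover w prj.
Hypothesis w2 : forall a, (2 <= w a)%N.
Local Notation A := (aut_pi prj).
Variable mu : {measure set (borel A) -> \bar R}.
Hypotheses (mu_left : left_haar mu) (mu_right : right_invariant mu).

Definition transporter (x y : VT + ET) : set A := [set g | act g x = y].

Lemma open_transporter x y : open (transporter x y).
Proof.
rewrite openE => g gx; apply/nbhs_autP; exists [:: x] => h hg.
by rewrite /transporter /= hg ?inE.
Qed.

Lemma measurable_transporter x y : measurable (transporter x y : set (borel A)).
Proof. by apply: sub_sigma_algebra; exact: open_transporter. Qed.

Lemma act1 x : act (1%g : A) x = x. Proof. exact: act_one. Qed.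
Lemma actM (g h : A) x : act (g * h)%g x = act g (act h x). Proof. exact: act_mul. Qed.
Lemma actK (g : A) : cancel (act g) (act (g^-1)%g). Proof. exact: act_invK. Qed.

Lemma mu_transporter x y (g : A) : act g x = y -> mu (transporter x y) = mu (stab prj x).
Proof.
move=> gx; have [inv _ _ _ _] := mu_left.
rewrite -(inv g (stab prj x) (measurable_transporter x x)); congr (mu _).
apply/seteqP; split=> h /=.
  move=> hx; exists (g^-1 * h)%g; last by rewrite mulgA mulgV mul1g.
  by rewrite /stab /= actM hx -gx actK.
by move=> [k kx <-]; rewrite /transporter /= actM kx.
Qed.

(** The transporter from x to gx is both the left coset of the stabiliser of x and the right coset
    of the stabiliser of gx by g. Unimodularity enters here, through right invariance. *)
Lemma mu_stab_act (g : A) x : mu (stab prj (act g x)) = mu (stab prj x).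
Proof.
rewrite -(@mu_transporter x (act g x) g)//.
rewrite -(mu_right g (measurable_transporter (act g x) (act g x))).
congr (mu _); apply/seteqP; split=> h /=.
  by move=> [k kx <-]; rewrite /transporter /= actM kx.
move=> hx; exists (h * g^-1)%g; last by rewrite -mulgA mulVg mulg1.
by rewrite /transporter /= actM actK.
Qed.

Lemma act_prj (g : A) x : hom_cell prj (act g x) = hom_cell prj x.
Proof. exact: autpiE. Qed.

Lemma orbit_edges e e' : homE prj e = homE prj e' <-> exists g : A, act g (inr e) = inr e'.
Proof.
split; last by move=> [g ge]; have := act_prj g (inr e); rewrite ge => -[].
have [L [I [IP LP]]] := fiber_labels cover.
by apply: (edge_transitive cover IP LP).
Qed.

(** Reduces to edges: if [v] and [v'] differ, some edge leaves [v], and its image also has a lift at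
    [v']; an automorphism matching these two edges matches their origins. *)
Lemma orbit_vertices v v' : homV prj v = homV prj v' <->
  exists g : A, act g (inl v) = inl v'.
Proof.
split; last by move=> [g gv]; have := act_prj g (inl v); rewrite gv => -[].
move=> vv'; have [[_ cT _] _ _] := cover.
have [L [I [IP LP]]] := fiber_labels cover.
have [[|e l] [wl el]] := connected_walk cT v v'.
  by exists 1%g; rewrite act1 -el.
have oe : org T e = v by move: wl => /= /andP[/eqP].
have [ o1 p1 _] := IP v' (homE prj e) 0%N
  (etrans (esym vv') (etrans (congr1 _ (esym oe)) (hom_org prj e)))
  (leq_trans (isT : (0 < 2)%N) (w2 _)).
have [g ge] := (orbit_edges e (I v' (homE prj e) 0%N)).1 (esym p1).
exists g; move: ge; rewrite /act /= => -[ge]; congr inl.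
by rewrite -oe -o1 -ge hom_org.
Qed.

Lemma mu_stab_einv e : mu (stab prj (inr (einv T e))) = mu (stab prj (inr e)).
Proof.
congr (mu _); apply/seteqP; split=> g; rewrite /stab /act /= => -[h]; congr inr.
  by apply: (can_inj (einvK T)); rewrite -hom_einv.
by rewrite hom_einv h.
Qed.

(** Orbit and stabiliser: the stabiliser of the origin splits into cosets of the stabiliser of [e],
    one for each of the edges with the same origin and the same image as [e]. *)
Lemma mu_stab_org e :
  mu (stab prj (inl (org T e))) = (mu (stab prj (inr e)) *+ w (homE prj e))%E.
Proof.
have [L [I [IP LP]]] := fiber_labels cover.
pose a := homE prj e; pose f (i : nat) := I (org T e) a i.
have fP i : (i < w a)%N -> [/\ org T (f i) = org T e, homE prj (f i) = a & L (f i) = i].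
  by apply: IP => //; exact: hom_org.
have -> : stab prj (inl (org T e)) =
    \bigcup_(i < w a) transporter (inr e) (inr (f i)).
  apply/seteqP; split=> g.
    rewrite /stab /act /= => -[ge]; have [lw lI] := LP (homE (aut_hom g) e).
    have pg : homE prj (homE (aut_hom g) e) = a by have := act_prj g (inr e) => -[].
    exists (L (homE (aut_hom g) e)); first by rewrite /= -pg.
    rewrite /transporter /act /= /f -pg; congr inr.
    by rewrite -{1}lI -hom_org ge.
  move=> [i /= /fP[ o1 _ _]]; rewrite /stab /transporter /act /= => -[ge]; congr inl.
  by rewrite hom_org ge.
pose F i : set (borel A) := transporter (inr e) (inr (f i)).
have -> : mu (\bigcup_(i < w a) transporter (inr e) (inr (f i))) =
    mu (\big[setU/set0]_(i < w a) F i) by rewrite -bigcup_mkord.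
rewrite measure_semi_additive_ord_I; first last.
- by apply: bigsetU_measurable => i _; exact: measurable_transporter.
- apply/trivIsetP => i j /= iw jw ij; rewrite -subset0 => g [].
  rewrite /F /transporter /= => -> [fij]; move/eqP: ij; apply.
  by have [_ _ <-] := fP _ iw; have [_ _ <-] := fP _ jw; rewrite fij.
- by move=> i _; exact: measurable_transporter.
rewrite (eq_bigr (fun=> mu (stab prj (inr e)))); first by rewrite sumr_const card_ord.
move=> i _; have [_ p1 _] := fP i (ltn_ord i).
have [g ge] := (orbit_edges e (f i)).1 (esym p1).
exact: mu_transporter ge.
Qed.

Lemma mu_stab_gt0 x : (0 < mu (stab prj x))%E.
Proof.
have [_ _ pos _ _] := mu_left; apply: pos; first exact: open_transporter.
by exists 1%g; rewrite /stab /= act1.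
Qed.

Lemma mu_stab_fin_edge e :
  (mu (stab prj (inl (org T e))) < +oo)%E = (mu (stab prj (inr e)) < +oo)%E.
Proof.
have w0 : (0 < w (homE prj e))%N by exact: leq_trans (w2 _).
rewrite mu_stab_org -mule_natl; have := measure_ge0 mu (stab prj (inr e)).
case: (mu _) => [r| |] //= _; first by rewrite -EFinM !ltry.
  by rewrite gt0_muley// lte_fin ltr0n.
by rewrite gt0_muleNy// lte_fin ltr0n.
Qed.

(** Finiteness spreads from [t] along paths, because the stabilisers of an edge and of its end have
    measures that differ by a positive integer factor. *)
Lemma mu_stab_fin t : mu (stab prj t) = 1%:E -> forall x, mu (stab prj x) \is a fin_num.
Proof.
move=> mut; have [[_ cT _] _ _] := cover.
suff vfin v : (mu (stab prj (inl v)) < +oo)%E.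
  by case=> [v|e]; rewrite ge0_fin_numE// -mu_stab_fin_edge.
have [v0 v0fin] : exists v0, (mu (stab prj (inl v0)) < +oo)%E.
  case: t mut => [v0|e] mut; first by exists v0; rewrite mut ltry.
  by exists (org T e); rewrite mu_stab_fin_edge mut ltry.
have [l [wl <-]] := connected_walk cT v0 v.
elim: l v0 v0fin wl => // e l IH v0 v0fin /= /andP[/eqP oe wl].
have tfin : (mu (stab prj (inl (tgt T e))) < +oo)%E.
  by rewrite -org_einv mu_stab_fin_edge mu_stab_einv -mu_stab_fin_edge oe.
exact: IH _ tfin wl.
Qed.

Definition cell_weight x : R := (fine (mu (stab prj x)))^-1.

Variable t : VT + ET.
Hypothesis mut : mu (stab prj t) = 1%:E.

Lemma cell_weight_gt0 x : 0 < cell_weight x.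
Proof.
rewrite invr_gt0 fine_gt0// mu_stab_gt0 /=.
by have := mu_stab_fin mut x; rewrite ge0_fin_numE.
Qed.

Lemma cell_weight_edge e :
  cell_weight (inr e) = (w (homE prj e))%:R * cell_weight (inl (org T e)).
Proof.
have w0 : (w (homE prj e))%:R != 0 :> R by rewrite pnatr_eq0 -lt0n (leq_trans _ (w2 _)).
rewrite /cell_weight mu_stab_org -mule_natl; have := mu_stab_fin mut (inr e).
case: (mu _) => // r _ /=; rewrite invfM mulrA divff ?mul1r//.
Qed.

Lemma cell_weight_einv e : cell_weight (inr (einv T e)) = cell_weight (inr e).
Proof. by rewrite /cell_weight mu_stab_einv. Qed.

Lemma cell_weight_orbit v v' : homV prj v = homV prj v' ->
  cell_weight (inl v) = cell_weight (inl v').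
Proof. by move=> /orbit_vertices[g <-]; rewrite /cell_weight mu_stab_act. Qed.

(** Both sides of the balance equation are the weight of one edge over [a], computed from its two
    ends. *)
Lemma base_weight : exists c : V -> R,
  [/\ forall v, 0 < c v,
      forall a, (w a)%:R * c (org G a) = (w (einv G a))%:R * c (tgt G a),
      forall v, cell_weight (inl v) = c (homV prj v) &
      forall e, cell_weight (inr e) = (w (homE prj e))%:R * c (org G (homE prj e))].
Proof.
have [_ prj_surj _] := cover.
have /choice[s sP] : forall v : V, exists v', homV prj v' = v.
  by move=> v; have [[v'|//] [<-]] := prj_surj (inl v); exists v'.
have cE v : cell_weight (inl v) = cell_weight (inl (s (homV prj v))).
  by apply: cell_weight_orbit; rewrite sP.
have ceE e : cell_weight (inr e) =
    (w (homE prj e))%:R * cell_weight (inl (s (org G (homE prj e)))).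
  by rewrite cell_weight_edge cE hom_org.
exists (fun v => cell_weight (inl (s v))); split=> //.
  by move=> v; exact: cell_weight_gt0.
move=> a; have [[//|e] [<-]] := prj_surj (inr a).
by rewrite -ceE -cell_weight_einv ceE hom_einv org_einv.
Qed.

(** The orbits are the fibres of [prj], so representatives correspond to cells of the base. The
    invariant orientation descends to the orientation [P] of the base, and the symmetry of edge
    weights under inversion makes the sum over [P] half of the full sum. *)
Lemma euler_char_base (c : V -> R) (Bv O Be : set (VT + ET)) :
  (forall v, cell_weight (inl v) = c (homV prj v)) ->
  (forall e, cell_weight (inr e) = (w (homE prj e))%:R * c (org G (homE prj e))) ->
  orbit_representatives prj (vertices VT ET) Bv ->
  invariant_orientation prj O -> orbit_representatives prj O Be ->
  euler_char mu Bv Be =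
    \sum_v c v - 2^-1 * \sum_a (w a)%:R * c (org G a).
Proof.
move=> cv ce [Bvsub BvP] [ OE Oinv Oact] [BeO BeP]; rewrite /euler_char.
have [_ prj_surj _] := cover.
congr (_ - _).
  have /choice[b bP] : forall v : V, exists v', homV prj v' = v /\ Bv (inl v').
    move=> v; have [[v'|//] [<-]] := prj_surj (inl v).
    have [b [[Bb [g gb]] _]] := BvP (inl v') (ex_intro2 _ _ v' I erefl).
    have [v1 _ v1b] := Bvsub _ Bb; exists v1; split; last by rewrite v1b.
    by have := act_prj g (inl v'); rewrite gb -v1b => -[].
  rewrite (fsbigE [seq inl (b v) | v <- enum V]).
  - rewrite big_map big_enum_cond; apply: eq_big => v.
      by rewrite mem_set//; have [] := bP v.
    by move=> _; rewrite -/(cell_weight _) cv; have [->] := bP v.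
  - rewrite map_inj_uniq ?enum_uniq// => x y [xy].
    by have [<- _] := bP x; have [<- _] := bP y; rewrite xy.
  - by move=> x /= /mapP[v _ ->]; have [] := bP v.
  move=> x Bx; have [v _ vx] := Bvsub _ Bx; rewrite -vx => /negP[].
  apply/mapP; exists (homV prj v); first by rewrite mem_enum.
  have [bv Bb] := bP (homV prj v).
  have [y [_ yu]] := BvP (inl v) (ex_intro2 _ _ v I erefl).
  rewrite -(yu (inl v)); last by split; [rewrite vx|exists 1%g; rewrite act1].
  rewrite -(yu (inl (b (homV prj v))))//; split=> //.
  by apply/orbit_vertices; rewrite bv.
have Ofib e e' : homE prj e = homE prj e' -> O (inr e) -> O (inr e').
  by move=> /orbit_edges[g <-] Oe; exact: Oact.
have /choice[s sP] : forall a : E, exists e, homE prj e = a.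
  by move=> a; have [[//|e] [<-]] := prj_surj (inr a); exists e.
pose P a := `[< O (inr (s a)) >].
have PN a : P (einv G a) = ~~ P a.
  apply/idP/idP.
    move=> /asboolP Oa; apply/negP => /asboolP/Oinv; apply.
    by apply: Ofib Oa; rewrite sP hom_einv sP.
  move=> /negP nO; apply/asboolP.
  have : O (inr (einv T (s a))).
    by apply: contrapT => nOe; apply: nO; apply/asboolP/Oinv.
  by apply: Ofib; rewrite sP hom_einv sP.
have -> : 2^-1 * (\sum_a (w a)%:R * c (org G a)) = \sum_(a | P a) (w a)%:R * c (org G a).
  rewrite (bigID P) /=.
  have -> : \sum_(a | ~~ P a) (w a)%:R * c (org G a) =
      \sum_(a | P a) (w a)%:R * c (org G a).
    rewrite (reindex_inj (can_inj (einvK G))) /=; apply: eq_big => a.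
      by rewrite PN negbK.
    move=> _; rewrite -{1 2}(sP a) -hom_einv -ce cell_weight_einv ce.
    by rewrite sP.
  by lra.
have /choice[b bP] : forall a : E, exists e, P a -> homE prj e = a /\ Be (inr e).
  move=> a; case: (boolP (P a)) => [/asboolP Oa|_]; last by exists (s a).
  have [b [[Bb [g gb]] _]] := BeP _ Oa.
  have [e1 _ e1b] := OE _ (BeO _ Bb); exists e1 => _; split; last by rewrite e1b.
  by have := act_prj g (inr (s a)); rewrite gb -e1b => -[]; rewrite sP.
rewrite (fsbigE [seq inr (b a) | a <- enum E & P a]).
- rewrite big_map big_filter_cond big_enum_cond; apply: eq_big => a.
    case: (boolP (P a)) => // Pa; rewrite /= mem_set//; by have [] := bP _ Pa.
  move=> /andP[_ /andP[Pa _]]; rewrite -/(cell_weight _) ce; by have [->] := bP _ Pa.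
- rewrite map_inj_in_uniq; first by apply: filter_uniq; exact: enum_uniq.
  move=> x y.
  rewrite !mem_filter => /andP[Px _] /andP[Py _] [xy].
  by have [<- _] := bP x Px; have [<- _] := bP y Py; rewrite xy.
- by move=> x /= /mapP[a]; rewrite mem_filter => /andP[Pa _] ->; have [] := bP a Pa.
move=> x Bx; have [e _ ex] := OE _ (BeO _ Bx); rewrite -ex => /negP[].
have Oe : O (inr e) by rewrite ex; exact: BeO.
have Pe : P (homE prj e) by apply/asboolP; apply: Ofib Oe; rewrite sP.
apply/mapP; exists (homE prj e); first by rewrite mem_filter Pe mem_enum.
have [be Bb] := bP _ Pe.
have [y [_ yu]] := BeP (inr e) Oe.
rewrite -(yu (inr e)); last by split; [rewrite ex|exists 1%g; rewrite act1].
rewrite -(yu (inr (b (homE prj e))))//; split=> //.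
by apply/orbit_edges; rewrite be.
Qed.

End HaarWeights.

(** * The transfer operator at s = -1 *)

Section BaseGraph.
Variables (R : realType) (V E : finType) (G : graph V E) (w : E -> nat).
Hypothesis G_connected : connected_graph G.
Hypothesis G_cycles : forall c : seq E, is_cycle G c -> (size c < 2)%N.
Hypothesis w2 : forall a, (2 <= w a)%N.
Hypothesis w3 : forall a, (3 <= w a)%N \/ (3 <= w (einv G a))%N.
Variable c : V -> R.
Hypothesis c_gt0 : forall v, 0 < c v.
Hypothesis c_balance : forall a, (w a)%:R * c (org G a) = (w (einv G a))%:R * c (tgt G a).
Local Notation C := (R[i]).

Definition loop a := org G a == tgt G a.

(* On functions taking the same value at a loop and at its inverse, the transfer
   operators of [rho] and of the edge inversion agree; but at [s = -1] only the
   former leaves [1 - transfer] invertible. *)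
Definition rho (a : E) : E := if loop a then a else einv G a.

Lemma loop_einv a : loop (einv G a) = loop a.
Proof. by rewrite /loop org_einv tgt_einv eq_sym. Qed.

Lemma rhoK : involutive rho.
Proof.
move=> a; rewrite /rho; case: (boolP (loop a)) => la; first by rewrite la.
by rewrite loop_einv (negbTE la) einvK.
Qed.

Lemma org_rho a : org G (rho a) = tgt G a.
Proof. by rewrite /rho; case: ifP => [/eqP//|_]; exact: org_einv. Qed.

Lemma w_loop a : loop a -> w (einv G a) = w a.
Proof.
move=> /eqP la; have /eqP := c_balance a.
by rewrite la (inj_eq (mulIf (lt0r_neq0 (c_gt0 _)))) eqr_nat => /eqP.
Qed.

Lemma w3_loop a : loop a -> (3 <= w a)%N.
Proof. by move=> la; have := w3 a; rewrite (w_loop la) => -[]. Qed.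

Lemma w3_rho a : (3 <= w a)%N \/ (3 <= w (rho a))%N.
Proof. by rewrite /rho; case: ifP => [/w3_loop|_]; [left|exact: w3]. Qed.

Lemma connected_const (A : Type) (f : V -> A) :
  (forall a, f (tgt G a) = f (org G a)) -> forall u v, f u = f v.
Proof.
move=> fE u v; have [l [wl <-]] := connected_walk G_connected u v.
elim: l u wl => //= a l IH u /andP[/eqP <- /IH wl].
by rewrite -fE wl.
Qed.

Definition edge_weight a : R := (w a)%:R * c (org G a).

Lemma edge_weight_einv a : edge_weight (einv G a) = edge_weight a.
Proof. by rewrite /edge_weight org_einv c_balance. Qed.

(* Half the sum over all edges is the sum over an orientation. *)
Definition chi : R := \sum_v c v - 2^-1 * \sum_a edge_weight a.

(** A spanning tree rooted at [r]: [p v] is the first edge of a shortest walk from [v] to [r], and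
    [a0] supplies a value at the root. *)
Lemma dist_parent (r : V) (a0 : E) : exists (p : V -> E) (d : V -> nat),
  forall v, v != r -> org G (p v) = v /\ (d (tgt G (p v)) < d v)%N.
Proof.
have ex v : exists n, [exists l : n.-tuple E, walk G v l && (wend G v l == r)].
  have [l [wl el]] := connected_walk G_connected v r.
  exists (size l); apply/existsP; exists (in_tuple l).
  by rewrite /= wl el eqxx.
pose d v := ex_minn (ex v).
have dP v l : walk G v l -> wend G v l = r -> (d v <= size l)%N.
  move=> wl el; rewrite /d; case: ex_minnP => n _; apply.
  by apply/existsP; exists (in_tuple l); rewrite /= wl el eqxx.
have step v : exists a, v != r -> org G a = v /\ (d (tgt G a) < d v)%N.
  have [->|vr] := eqVneq v r; first by exists a0.
  rewrite {2}/d; case: ex_minnP => n /existsP[l /andP[wl /eqP el]] _.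
  move: wl el (size_tuple l); case: (tval l) => [|a m] /=.
    by move=> _ vr'; move: vr; rewrite -vr' eqxx.
  move=> /andP[/eqP oa wm] em <-; exists a => _; split=> //.
  by rewrite ltnS; exact: dP.
have /choice[p pP] := step.
by exists p, d.
Qed.

(* Root the graph at a vertex of minimal weight: the parent edge of [v] weighs at
   least [2 * c v], and some parent edge also pays for the root. *)
Lemma chi_lt0 (a0 : E) : chi < 0.
Proof.
have [r rP] : exists r, forall v, c r <= c v.
  by exists [arg min_(v < org G a0) c v]%O; case: arg_minP => // r _ h v; exact: h.
have [p [d pd]] := dist_parent r a0.
have Wpos a : 0 < edge_weight a by rewrite mulr_gt0// ltr0n (leq_trans _ (w2 a)).
have wR n a : (n <= w a)%N -> n%:R <= (w a)%:R :> R by rewrite ler_nat.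
rewrite /chi subr_lt0; have [v1 v1r|allr] := pickP (fun v => v != r); last first.
  (* With a single vertex every edge is a loop of weight at least [3 * c r], and half the
     contribution of the loop and its inverse already exceeds [c r]. *)
  have vr v : v = r by have /negbFE/eqP := allr v.
  have la : loop a0 by rewrite /loop (vr (org G a0)) (vr (tgt G a0)).
  have -> : \sum_v c v = c r.
    by rewrite (bigD1 r)//= big1 ?addr0// => v; rewrite (vr v) eqxx.
  have : edge_weight a0 + edge_weight (einv G a0) <= \sum_a edge_weight a.
    rewrite (bigD1 a0)//= lerD2l [leRHS](bigD1 (einv G a0)) /=; last exact/eqP/einv_neq.
    by rewrite lerDl sumr_ge0// => a _; exact: ltW.
  have : 3 * c r <= edge_weight a0.
    rewrite /edge_weight (vr (org G a0)); apply: ler_wpM2r (ltW _) _ _ _ => //.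
    exact: (wR 3%N a0 (w3_loop la)).
  by rewrite edge_weight_einv; have := c_gt0 r; lra.
have Wp v : v != r -> 2 * c v <= edge_weight (p v).
  move=> /pd[ ov _]; rewrite /edge_weight ov; apply: ler_wpM2r (ltW _) _ _ _ => //.
  exact: (wR 2%N).
(* Write W for the weight of this edge. If its label at [v1] is at least 3, then W is at least 3
   c(v1), and c(r) is minimal. Otherwise W is at least 3 c(r) and at least 2 c(v1), so c(v1) + c(r)
   is at most 5/6 of W. *)
have Wp1 : c v1 + c r < edge_weight (p v1).
  have [ ov _] := pd _ v1r; have W2 := Wp _ v1r.
  have cr := c_gt0 r; have r1 := rP v1; have r2 := rP (tgt G (p v1)).
  case: (w3 (p v1)) => /wR h.
    have : 3 * c v1 <= edge_weight (p v1).
      by rewrite /edge_weight ov; apply: ler_wpM2r (ltW _) _ _ _.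
    lra.
  have : 3 * c (tgt G (p v1)) <= edge_weight (p v1).
    by rewrite /edge_weight c_balance; apply: ler_wpM2r (ltW _) _ _ _.
  lra.
pose s0 := [seq v <- enum V | v != r].
pose s := [seq p v | v <- s0] ++ [seq einv G (p v) | v <- s0].
have us0 : uniq s0 by rewrite filter_uniq// enum_uniq.
have s0r v : v \in s0 -> v != r by rewrite mem_filter => /andP[].
(* Parent edges strictly decrease the distance to [r], so a parent edge is never the inverse of
   another one. *)
have us : uniq s.
  rewrite cat_uniq; apply/and3P; split.
  - rewrite map_inj_in_uniq// => x y /s0r xr /s0r yr pxy.
    by have [<- _] := pd _ xr; have [<- _] := pd _ yr; rewrite pxy.
  - apply/hasPn => a /mapP[x /s0r xr ->]; apply/negP => /mapP[y /s0r yr h].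
    have [ ox dx] := pd _ xr; have [ oy dy] := pd _ yr.
    have tx : tgt G (p y) = x by rewrite -h tgt_einv.
    have ty : tgt G (p x) = y by rewrite -oy -h org_einv.
    by move: dx dy; rewrite tx ty; lia.
  - rewrite map_inj_in_uniq// => x y /s0r xr /s0r yr /(can_inj (einvK G)) pxy.
    by have [<- _] := pd _ xr; have [<- _] := pd _ yr; rewrite pxy.
have sE : \sum_(a <- s) edge_weight a = 2 * \sum_(v | v != r) edge_weight (p v).
  rewrite big_cat !big_map /=.
  rewrite (eq_bigr (fun v => edge_weight (p v)) (fun v _ => edge_weight_einv (p v))).
  rewrite /s0 big_filter big_enum_cond /=; lra.
have : \sum_(a <- s) edge_weight a <= \sum_a edge_weight a.
  rewrite -[leRHS]big_enum; apply: ler_sum_uniq_sub => //.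
  - exact: enum_uniq.
  - by move=> a _; rewrite mem_enum.
  - by move=> a; exact: ltW.
rewrite sE => sW.
have : \sum_v c v < \sum_(v | v != r) edge_weight (p v).
  rewrite (bigD1 r)//= (bigD1 v1)//= [ltRHS](bigD1 v1)//= addrA.
  apply: ltr_leD; first by rewrite addrC.
  apply: ler_sum => v /andP[vr _]; have := Wp _ vr; have := c_gt0 v; lra.
lra.
Qed.

Definition out_sum (x : E -> C) (v : V) : C := \sum_(b | org G b == v) (w b)%:R * x b.

Lemma app_at1 (x : E -> C) a :
  kernel_app (transfer G w rho (-1)) x a = out_sum x (tgt G a) - x (rho a).
Proof.
rewrite /kernel_app /out_sum (bigD1 (rho a)) //= [in RHS](bigD1 (rho a)) /= ?org_rho//.
rewrite {1}/transfer /composable org_rho !eqxx opprK natpowC_at1 ?weight_gt0//.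
rewrite natrB ?(leq_trans _ (w2 _))// mulrBl mul1r addrAC; congr (_ + _ - _).
rewrite [RHS]big_mkcondl; apply: eq_bigr => b bra.
rewrite /transfer /composable eq_sym; case: eqP => _; last by rewrite mul0r.
by rewrite (negbTE bra) subn0 opprK natpowC_at1// (leq_trans _ (w2 _)).
Qed.

Lemma edge_weight_sym_sum (x : E -> C) :
  \sum_a (edge_weight a)%:C%C * x a =
  2^-1 * \sum_a (edge_weight a)%:C%C * (x a + x (einv G a)).
Proof.
under [in RHS]eq_bigr do rewrite mulrDr.
rewrite big_split /=.
have -> : \sum_a (edge_weight a)%:C%C * x (einv G a) = \sum_a (edge_weight a)%:C%C * x a.
  rewrite [RHS](reindex_inj (can_inj (einvK G))) /=.
  by apply: eq_bigr => a _; rewrite edge_weight_einv.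
by field.
Qed.

(* At [s = -1] summing the equations over [a] and its inverse makes the
   vertex sums constant, up to the source term; the weights [c] then turn
   the system into one scalar equation. *)
Lemma solve_at1 (v0 : V) (x y z : E -> C) (r : V -> C) :
  (forall a, y a = r (tgt G a) + z a) -> (forall a, z (einv G a) = z a) ->
  (forall a, x a = y a + kernel_app (transfer G w rho (-1)) x a) ->
  exists k : C, [/\ forall v, out_sum x v + r v = k,
    forall a, x a + x (einv G a) = k + z a &
    k * chi%:C%C = \sum_v (c v)%:C%C * r v + 2^-1 * \sum_a (edge_weight a)%:C%C * z a].
Proof.
move=> yE zE xE.
(* The source splits into a part [r] seen only through the end vertex, absorbed in [f], and a part
   [z] invariant under inversion. The vertex series has z = 0, the edge series r = 0. *)
pose f v := out_sum x v + r v.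
have xrho a : x a + x (rho a) = f (tgt G a) + z a.
  by rewrite xE app_at1 yE /f; ring.
(* On a loop the equations read 2 x(a) = f + z(a) and 2 x(abar) = f + z(a), so the two values agree
   and the relation with the inverse edge follows. *)
have xinv a : x a + x (einv G a) = f (tgt G a) + z a.
  have := xrho a; rewrite /rho; case: (boolP (loop a)) => // la h.
  have := xrho (einv G a); rewrite /rho loop_einv la zE tgt_einv (eqP la) -h => h2.
  congr (_ + _).
  have : (2 : C) * x (einv G a) = 2 * x a by rewrite !mulr_natl !mulr2n.
  by apply: mulfI; rewrite pnatr_eq0.
have fconst a : f (tgt G a) = f (org G a).
  have h := xinv (einv G a); rewrite einvK tgt_einv zE in h.
  by apply: (addIr (z a)); rewrite -xinv -h addrC.
exists (f v0); split.
- by move=> v; exact: connected_const fconst v v0.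
- by move=> a; rewrite xinv; congr (_ + _); exact: connected_const.
have cf : \sum_v (c v)%:C%C * out_sum x v = \sum_a (edge_weight a)%:C%C * x a.
  rewrite /out_sum; under eq_bigr do rewrite mulr_sumr.
  rewrite (exchange_big_dep xpredT) //=; apply: eq_bigr => a _.
  by rewrite (big_pred1 (org G a)) // /edge_weight rmorphM rmorph_nat mulrA [_%:R * _]mulrC.
have e1 : \sum_v (c v)%:C%C * out_sum x v =
    f v0 * \sum_v (c v)%:C%C - \sum_v (c v)%:C%C * r v.
  rewrite mulr_sumr -sumrB; apply: eq_bigr => v _.
  have -> : f v0 = f v by apply: connected_const.
  by rewrite /f; ring.
have e2 : \sum_a (edge_weight a)%:C%C * x a =
    2^-1 * (f v0 * \sum_a (edge_weight a)%:C%C) + 2^-1 * \sum_a (edge_weight a)%:C%C * z a.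
  rewrite edge_weight_sym_sum -mulrDr; congr (_ * _).
  rewrite mulr_sumr -big_split; apply: eq_bigr => a _ /=.
  rewrite xinv; have -> : f (tgt G a) = f v0 by apply: connected_const.
  by ring.
have chiE : chi%:C%C = \sum_v (c v)%:C%C - 2^-1 * \sum_a (edge_weight a)%:C%C :> C.
  by rewrite /chi rmorphB rmorphM fmorphV rmorph_nat !rmorph_sum.
rewrite chiE mulrBr.
have := cf; rewrite e1 e2 => /eqP; rewrite subr_eq => /eqP ->.
by ring.
Qed.

(* A nonzero antisymmetric flow without sources can be followed forever
   without backtracking. *)
Lemma kernel_at1 (x : E -> C) :
  (forall a, x a = kernel_app (transfer G w rho (-1)) x a) -> forall a, x a = 0.
Proof.
move=> xE a0.
have [k [kv ka kchi]] : exists k : C, [/\ forall v, out_sum x v + 0 = k,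
    forall a, x a + x (einv G a) = k + 0 &
    k * chi%:C%C = \sum_v (c v)%:C%C * 0 + 2^-1 * \sum_a (edge_weight a)%:C%C * 0].
  apply: (@solve_at1 (org G a0) x (fun=> 0) (fun=> 0) (fun=> 0)) => //.
    by move=> a; rewrite addr0.
  by move=> a; rewrite add0r.
have k0 : k = 0.
  move: kchi; rewrite !big1 ?mulr0 ?addr0; try by move=> *; rewrite mulr0.
  move=> /eqP; rewrite mulf_eq0 => /orP[/eqP//|].
  by rewrite (inj_eq (@complexI R)) lt_eqF// (chi_lt0 a0).
have anti a : x (einv G a) = - x a.
  by apply/eqP; rewrite -addr_eq0 addrC ka k0 addr0.
have div0 v : out_sum x v = 0 by rewrite -[LHS]addr0 kv k0.
(* At a loop the exceptional entry is diagonal, so the equation becomes x(a) = -x(a). *)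
have x_loop a : loop a -> x a = 0.
  move=> la; have := xE a; rewrite app_at1 div0 sub0r /rho la => /eqP.
  by rewrite -subr_eq0 opprK -mulr2n mulrn_eq0 => /eqP.
apply/eqP/negPn/negP => xa0.
pose S : pred E := fun a => x a != 0.
(* The weighted sum at the target of [a] vanishes, but the inverse of [a] contributes a nonzero
   term; another outgoing edge must compensate it. *)
have next a : exists b, S a -> [/\ S b, composable G a b & b != einv G a].
  case: (boolP (S a)) => Sa; last by exists a.
  have [b /and3P[h1 h2 h3]|none] :=
    pickP (fun b => [&& S b, composable G a b & b != einv G a]); first by exists b.
  exfalso; have := div0 (tgt G a).
  rewrite /out_sum (bigD1 (einv G a)) ?org_einv//= big1 ?addr0.
    move=> /eqP; rewrite mulf_eq0 pnatr_eq0 anti oppr_eq0 (negbTE Sa) orbF.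
    by have := w2 (einv G a); case: (w _).
  move=> b /andP[ ob bi]; have := none b.
  by rewrite /composable eq_sym ob bi !andbT /S => /negbFE/eqP ->; rewrite mulr0.
have /choice[nx nxP] := next.
pose n := fingraph.order nx a0.
have Siter m : S (iter m nx a0) by elim: m => //= m IH; have [] := nxP _ IH.
have /trajectP[i iN E1] := looping_order nx a0.
(* By finiteness the orbit of [nx] returns to [b]. The list [nx b :: l] has [n - i] edges and ends
   with [b], so it is a closed reduced path in the support of [x]; it contains a cycle, hence a
   loop, where [x] vanishes. *)
pose b := iter i nx a0; pose l := traject nx (nx (nx b)) (n - i).-1.
have ni : (0 < n - i)%N by rewrite subn_gt0.
have Sl : all S (nx b :: l).
  apply/allP => d.
  have -> : nx b :: l = traject nx (nx b) (n - i) by rewrite -(prednK ni).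
  by move=> /trajectP[m _ ->]; rewrite /b -iterSr -iterD.
have lastl : last (nx b) l = b.
  rewrite /l last_traject -iterSr prednK// /b -iterD subnK ?(ltnW iN)//.
have pl : path (frel nx) (nx b) l by exact: fpath_traject.
have sub : {in S &, subrel (frel nx) (composable G)}.
  by move=> u v Su _ /= /eqP <-; have [] := nxP _ Su.
have sub' : {in S &, subrel (frel nx) (nonback G)}.
  by move=> u v Su _ /= /eqP <-; have [] := nxP _ Su.
have [|||d dc ds] := @closed_reduced_cycle _ _ G (nx b) l.
- exact: sub_in_path Sl pl.
- exact: sub_in_path Sl pl.
- by rewrite lastl; have [_ /eqP] := nxP _ (Siter i).
have := G_cycles dc; case: d dc ds => [//|d [|//]] /= + ds _.
rewrite andbT => ld.
have /(allP Sl) : d \in nx b :: l by apply: ds; rewrite inE.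
by rewrite /S x_loop ?eqxx.
Qed.

Lemma rho_loop a : loop a -> rho a = a.
Proof. by rewrite /rho => ->. Qed.

Lemma sum_loop (F : E -> C) a :
  \sum_b F b = F a + F (einv G a) + \sum_(b | (b != a) && (b != einv G a)) F b.
Proof.
rewrite (bigD1 a)//= (bigD1 (einv G a)) /= ?addrA//.
by apply/eqP; exact: einv_neq.
Qed.

Lemma loop_tgt_einv a : loop a -> tgt G (einv G a) = tgt G a.
Proof. by rewrite tgt_einv => /eqP. Qed.

(** In the row of a loop the two operators differ by exchanging the entries at the loop and at its
    inverse, whose labels are equal; a function with equal values there does not notice. *)
Lemma app_rho_einv s (x : E -> C) a :
  (forall b, loop b -> x (einv G b) = x b) ->
  kernel_app (transfer G w rho s) x a = kernel_app (transfer G w (einv G) s) x a.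
Proof.
move=> xl; case: (boolP (loop a)) => la; last first.
  by apply: eq_bigr => b _; rewrite /transfer /rho (negbTE la).
rewrite /kernel_app !(sum_loop _ a) xl// -!mulrDl; congr (_ * _ + _).
  rewrite /transfer /composable org_einv -(eqP la) eqxx rho_loop// w_loop// !eqxx.
  have na : einv G a == a = false by exact/eqP/einv_neq.
  by rewrite na [a == _]eq_sym na addrC.
apply: eq_bigr => b /andP[ba bia].
by rewrite /transfer rho_loop// (negbTE ba) (negbTE bia).
Qed.

(** The rows of a loop and of its inverse agree outside a block with diagonal entries [p] and
    off-diagonal entries [q]. Subtracting the two equations leaves the factor 1 - (p - q), nonzero
    because the contraction bounds |p| + |q| by 3/4. *)
Lemma loop_sym_solution s (x y : E -> C) :
  (forall a, \sum_b `|transfer G w rho s a b| * backtrack_weight R w rho b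
     <= 3 / 4 * backtrack_weight R w rho a) ->
  (forall a, loop a -> y (einv G a) = y a) ->
  (forall a, x a = y a + kernel_app (transfer G w rho s) x a) ->
  forall a, loop a -> x (einv G a) = x a.
Proof.
move=> hK yl xE a la.
have na : a == einv G a = false by rewrite eq_sym; exact/eqP/einv_neq.
have lia : loop (einv G a) by rewrite loop_einv.
pose p : C := natpowC (w a - 1)%N (- s); pose q : C := natpowC (w a) (- s).
have Kaa : transfer G w rho s a a = p.
  by rewrite /transfer /composable -(eqP la) eqxx rho_loop// eqxx.
have Kai : transfer G w rho s a (einv G a) = q.
  by rewrite /transfer /composable org_einv eqxx rho_loop// eq_sym na w_loop// subn0.
have Kia : transfer G w rho s (einv G a) a = q.
  by rewrite /transfer /composable tgt_einv eqxx rho_loop// na subn0.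
have Kii : transfer G w rho s (einv G a) (einv G a) = p.
  by rewrite /transfer /composable tgt_einv org_einv (eqP la) eqxx rho_loop// eqxx w_loop.
have h1 b : loop b -> backtrack_weight R w rho b = 1.
  move=> lb; rewrite /backtrack_weight rho_loop//; case: eqP => // w2b.
  by have := w3_loop lb; rewrite w2b.
have pq : `|p| + `|q| <= 3 / 4.
  apply: le_trans (_ : 3 / 4 * backtrack_weight R w rho a <= _); last by rewrite h1// mulr1.
  apply: le_trans (hK a); rewrite (sum_loop _ a) Kaa Kai !h1// !mulr1 lerDl.
  by apply: sumr_ge0 => b _; rewrite mulr_ge0// (le_trans ler01)// hweight_ge1.
have D : (1 - (p - q)) * (x a - x (einv G a)) = 0.
  have e : x a - x (einv G a) = kernel_app (transfer G w rho s) x a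
      - kernel_app (transfer G w rho s) x (einv G a).
    by rewrite {1}(xE a) {1}(xE (einv G a)) yl//; ring.
  rewrite mulrBl mul1r {1}e /kernel_app !(sum_loop _ a) Kaa Kai Kia Kii.
  have -> : \sum_(b | (b != a) && (b != einv G a)) transfer G w rho s (einv G a) b * x b =
     \sum_(b | (b != a) && (b != einv G a)) transfer G w rho s a b * x b.
    apply: eq_bigr => b /andP[ba bia]; congr (_ * _).
    by rewrite /transfer /composable loop_tgt_einv// !rho_loop// (negbTE ba) (negbTE bia).
  ring.
move/eqP: D; rewrite mulf_eq0 subr_eq0 => /orP[/eqP pq1|].
  have : (1 : C) <= 3 / 4.
    by apply: le_trans pq; rewrite -[leLHS](@normr1 C) pq1 ler_normB.
  rewrite ler_pdivlMr ?ltr0n// mul1r ler_nat//.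
by rewrite subr_eq0 => /eqP ->.
Qed.

End BaseGraph.

(** * The resolvent as a meromorphic function *)

Lemma cvg_div (R : realType) (F : set_system R[i]) (FF : Filter F)
    (f g : R[i] -> R[i]) (u v : R[i]) :
  f @ F --> u -> g @ F --> v -> v != 0 -> (fun s => f s / g s) @ F --> u / v.
Proof. by move=> fu gv v0; exact: (cvgM fu (cvgV v0 gv)). Qed.

Section Resolvent.
Variables (R : realType) (E : finType).
Local Notation C := (R[i]).

Definition resolvent_mx (K : E -> E -> C) : 'M[C]_#|E| :=
  \matrix_(i, j) ((i == j)%:R - K (enum_val i) (enum_val j)).

Definition resolvent (K : E -> E -> C) (y : E -> C) (a : E) : C :=
  (invmx (resolvent_mx K) *m \col_i y (enum_val i)) (enum_rank a) 0.

Lemma resolvent_mx_col (K : E -> E -> C) (x : E -> C) i :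
  (resolvent_mx K *m \col_j x (enum_val j)) i 0 =
  x (enum_val i) - kernel_app K x (enum_val i).
Proof.
rewrite mxE; under eq_bigr do rewrite !mxE mulrBl.
rewrite sumrB (bigD1 i)//= big1 => [|j ji]; last by rewrite eq_sym (negbTE ji) mul0r.
rewrite eqxx mul1r addr0; congr (_ - _).
rewrite /kernel_app [RHS](reindex_onto (fun j : 'I_#|E| => enum_val j) enum_rank) /=.
  by apply: eq_big => [j|//]; rewrite enum_valK eqxx.
by move=> b _; rewrite enum_rankK.
Qed.

Lemma resolvent_mx_unit (K : E -> E -> C) :
  (forall x, (forall a, x a = kernel_app K x a) -> forall a, x a = 0) ->
  resolvent_mx K \in unitmx.
Proof.
move=> inj; rewrite unitmxE unitfE -det_tr; apply/negP => /det0P[v v0 vK].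
move/eqP: v0; apply; apply/rowP => i; rewrite mxE.
pose x a := v 0 (enum_rank a).
have vE : v^T = \col_j x (enum_val j) by apply/colP => j; rewrite !mxE /x enum_valK.
have h : forall a, x a = kernel_app K x a.
  move=> a; apply/eqP; rewrite -subr_eq0 -[a]enum_rankK -resolvent_mx_col -vE.
  by rewrite -[resolvent_mx K]trmxK -trmx_mul vK trmx0 mxE.
by have := inj x h (enum_val i); rewrite /x enum_valK.
Qed.

Lemma resolventP (K : E -> E -> C) y : resolvent_mx K \in unitmx ->
  forall a, resolvent K y a = y a + kernel_app K (resolvent K y) a.
Proof.
move=> uK a; apply/eqP; rewrite -subr_eq -[a]enum_rankK -resolvent_mx_col.
have -> : \col_j resolvent K y (enum_val j) =
    invmx (resolvent_mx K) *m \col_i y (enum_val i).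
  by apply/colP => j; rewrite mxE /resolvent enum_valK.
by rewrite mulKVmx// mxE.
Qed.

Variables (K : C -> E -> E -> C) (y : E -> C).
Hypothesis K_exp : forall a b, exppoly (fun s => K s a b).
Variables (A : C -> C) (B : E -> C -> C).
Hypotheses (A_exp : exppoly A) (B_exp : forall a, exppoly (B a)).

Definition resolvent_value s := A s + \sum_a B a s * resolvent (K s) y a.

Definition resolvent_num s := A s * \det (resolvent_mx (K s)) +
  \sum_a B a s * \sum_i (\adj (resolvent_mx (K s))) (enum_rank a) i * y (enum_val i).

Lemma exppoly_resolvent_mx i j : exppoly (fun s => resolvent_mx (K s) i j).
Proof.
apply: (@exppoly_ext _ (fun s => (i == j)%:R + (-1) * K s (enum_val i) (enum_val j))).
  by move=> s; rewrite mxE mulN1r.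
by apply: exppolyD; [exact: exppoly_cst|apply: exppolyM; [exact: exppoly_cst|]].
Qed.

Lemma exppoly_det_resolvent : exppoly (fun s => \det (resolvent_mx (K s))).
Proof. by apply: exppoly_det => i j; exact: exppoly_resolvent_mx. Qed.

Lemma exppoly_resolvent_num : exppoly resolvent_num.
Proof.
apply: exppolyD; first by apply: exppolyM => //; exact: exppoly_det_resolvent.
apply: exppoly_sum => a; apply: exppolyM => //.
apply: exppoly_sum => i; apply: exppolyM; last exact: exppoly_cst.
by apply: exppoly_adj => k l; exact: exppoly_resolvent_mx.
Qed.

Lemma resolvent_valueE s : \det (resolvent_mx (K s)) != 0 ->
  resolvent_value s = resolvent_num s / \det (resolvent_mx (K s)).
Proof.
move=> d0; rewrite /resolvent_value /resolvent_num mulrDl mulfK//; congr (_ + _).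
rewrite mulr_suml; apply: eq_bigr => a _; rewrite -mulrA; congr (_ * _).
rewrite /resolvent /invmx unitmxE unitfE d0 -scalemxAl mxE mulrC; congr (_ * _).
by rewrite mxE; apply: eq_bigr => i _; congr (_ * _); rewrite mxE.
Qed.

(** Injectivity at [s0] serves twice. It shows that the determinant is not identically zero, so its
    zeros are isolated and the quotient is meromorphic on the whole plane; and it makes the quotient
    continuous at [s0], with value [k] computed from the linear system. *)
Lemma inverse_value_resolvent (D : C -> C -> Prop) (s0 k : C) (sigma : R) :
  (forall x, (forall a, x a = kernel_app (K s0) x a) -> forall a, x a = 0) ->
  (forall x, (forall a, x a = y a + kernel_app (K s0) x a) ->
    A s0 + \sum_a B a s0 * x a = k) ->
  k != 0 ->
  (forall s, sigma < complex.Re s ->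
    (forall x, (forall a, x a = kernel_app (K s) x a) -> forall a, x a = 0) /\
    (forall x, (forall a, x a = y a + kernel_app (K s) x a) ->
       D s (A s + \sum_a B a s * x a))) ->
  inverse_value D s0 k^-1.
Proof.
move=> inj0 sol0 k0 hD; exists resolvent_value.
  split; last first.
    exists sigma => s /hD[inj sol]; apply: sol => a; apply: resolventP.
    exact: resolvent_mx_unit.
  move=> z; exists resolvent_num, (fun s => \det (resolvent_mx (K s))); split.
  - by near=> x; apply: exppoly_derivable; exact: exppoly_resolvent_num.
  - by near=> x; apply: exppoly_derivable; exact: exppoly_det_resolvent.
  have := exppoly_isolated z exppoly_det_resolvent (z1 := s0).
  have := resolvent_mx_unit inj0; rewrite unitmxE unitfE => -> /(_ isT).
  by apply: filterS => s ds; split=> //; exact: resolvent_valueE.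
have d0 : \det (resolvent_mx (K s0)) != 0.
  by have := resolvent_mx_unit inj0; rewrite unitmxE unitfE.
have kE : resolvent_num s0 / \det (resolvent_mx (K s0)) = k.
  rewrite -resolvent_valueE//; apply: sol0; apply: resolventP.
  by rewrite unitmxE unitfE.
have n0 : resolvent_num s0 != 0 by apply: contraNneq k0 => n0; rewrite -kE n0 mul0r.
have cn : resolvent_num x @[x --> s0] --> resolvent_num s0.
  exact: (@exppoly_continuous _ _ exppoly_resolvent_num s0).
have cd : \det (resolvent_mx (K x)) @[x --> s0] --> \det (resolvent_mx (K s0)).
  exact: (@exppoly_continuous _ _ exppoly_det_resolvent s0).
have cvg1 : (fun s => \det (resolvent_mx (K s)) / resolvent_num s) @ s0 --> k^-1.
  have -> : k^-1 = \det (resolvent_mx (K s0)) / resolvent_num s0 by rewrite -kE invf_div.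
  exact: cvg_div cd cn n0.
have cvg2 := @cvg_within_filter _ _ _ _ _ _ (fun x => x != s0) cvg1.
have H : {near s0^', (fun s => \det (resolvent_mx (K s)) / resolvent_num s) =1
    (fun s => (resolvent_value s)^-1)}.
  near=> s.
  have ds : \det (resolvent_mx (K s)) != 0.
    by near: s; exact: exppoly_isolated exppoly_det_resolvent d0.
  by rewrite resolvent_valueE// invf_div.
exact: (cvg_trans (near_eq_cvg H) (cvg2 _)).
Unshelve. all: by end_near.
Qed.

End Resolvent.

(** * The zeta functions of a vertex and of an edge *)

Section ZetaValue.
Variables (R : realType) (V E : finType) (G : graph V E) (w : E -> nat).
Hypothesis G_connected : connected_graph G.
Hypothesis G_cycles : forall c : seq E, is_cycle G c -> (size c < 2)%N.
Hypothesis w2 : forall a, (2 <= w a)%N.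
Hypothesis w3 : forall a, (3 <= w a)%N \/ (3 <= w (einv G a))%N.
Variable c : V -> R.
Hypothesis c_gt0 : forall v, 0 < c v.
Hypothesis c_balance : forall a, (w a)%:R * c (org G a) = (w (einv G a))%:R * c (tgt G a).
Local Notation C := (R[i]).
Local Notation K := (transfer (R := R) G w (rho G)).
Local Notation chi := (chi G w c).

Lemma exppoly_transfer f a b : exppoly (fun s : C => transfer G w f s a b).
Proof.
rewrite /transfer; case: (composable _ _ _); last exact: exppoly_cst.
exact: exppoly_natpowC.
Qed.

Lemma contraction_inj (s : C) (x : E -> C) :
  (forall a, \sum_b `|K s a b| * backtrack_weight R w (rho G) b
     <= 3 / 4 * backtrack_weight R w (rho G) a) ->
  (forall a, x a = kernel_app (K s) x a) -> forall a, x a = 0.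
Proof.
move=> hK xE a.
have h : forall a, x a = (fun=> 0 : C) a + kernel_app (K s) x a by move=> b; rewrite add0r.
have iter0 n b : iter n (kernel_app (K s)) (fun=> 0) b = 0.
  elim: n b => //= n IH b; rewrite /kernel_app big1// => d _.
  by rewrite IH mulr0.
have := neumann_cvg hK h (a := a).
have -> : (fun N => \sum_(n < N) iter n (kernel_app (K s)) (fun=> 0) a) = (fun=> 0).
  by apply/funext => N; rewrite big1.
move=> cx; have c0 : (fun=> 0 : C) @ \oo --> (0 : C) by exact: cvg_cst.
exact: (cvg_unique _ cx c0).
Qed.

(** [A] and [B] express the zeta function through the solution of the linear system, and the reading
    at -1 is the constant [k] of [solve_at1]. The hypothesis that the weighted source sums to 1
    encodes c(u) = 1, so that [k] is the inverse of [chi]. *)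
Lemma inverse_value_zeta (D : C -> C -> Prop) (y z : E -> C) (r : V -> C)
    (A : C -> C) (B : E -> C -> C) (v0 : V) :
  exppoly A -> (forall a, exppoly (B a)) ->
  (forall a, y a = r (tgt G a) + z a) -> (forall a, z (einv G a) = z a) ->
  \sum_v (c v)%:C%C * r v + 2^-1 * \sum_a (edge_weight G w c a)%:C%C * z a = 1 ->
  (forall x k, (forall v, out_sum G w x v + r v = k) ->
     (forall a, x a + x (einv G a) = k + z a) -> A (-1) + \sum_a B a (-1) * x a = k) ->
  (forall s x,
    (forall s', complex.Re s' = complex.Re s -> forall a,
      \sum_b `|transfer G w (einv G) s' a b| * backtrack_weight R w (einv G) b
        <= 3 / 4 * backtrack_weight R w (einv G) a) ->
    0 <= complex.Re s ->
    (forall a, x a = y a + kernel_app (transfer G w (einv G) s) x a) ->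
    D s (A s + \sum_a B a s * x a)) ->
  inverse_value D (-1) chi%:C%C.
Proof.
move=> A_exp B_exp yE zE norm1 value_at1 Dsum.
have [s1 s10 hs1] := transfer_hweight R G w2 (@einvK _ _ G) w3.
have [s2 s20 hs2] := transfer_hweight R G w2 (rhoK G)
  (w3_rho w3 c_gt0 c_balance).
have inj x : (forall a, x a = kernel_app (K (-1)) x a) -> forall a, x a = 0.
  exact: kernel_at1.
have sol x : (forall a, x a = y a + kernel_app (K (-1)) x a) ->
    (A (-1) + \sum_a B a (-1) * x a) * chi%:C%C = 1.
  move=> xE; have [k [kv ka kchi]] :=
    solve_at1 G_connected w2 c_balance v0 yE zE xE.
  by rewrite (value_at1 x k)// kchi.
(* The negativity of [chi] was proved from an edge. Here a solution exists by invertibility, and its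
   value times [chi] is 1, which also covers a graph without edges. *)
have chi0 : chi%:C%C != 0 :> C.
  have uK := resolvent_mx_unit inj; apply/eqP => chi0.
  have := sol _ (resolventP y uK); rewrite chi0 mulr0 => /esym/eqP.
  by rewrite oner_eq0.
rewrite -[chi%:C%C]invrK.
apply: (@inverse_value_resolvent R E K y _ A B A_exp B_exp D (-1) _ (Num.max s1 s2)).
- by move=> a b; exact: exppoly_transfer.
- exact: inj.
- by move=> x /sol h; apply: (mulIf chi0); rewrite h mulVf.
- by rewrite invr_eq0.
move=> s; rewrite gt_max => /andP[ss1 ss2].
have hK := hs2 s ss2.
split=> x; first exact: contraction_inj.
move=> xE; apply: Dsum.
- by move=> s' es; apply: hs1; rewrite es.
- by apply: ltW; exact: le_lt_trans ss1.
(* The solution for [rho] takes equal values at a loop and at its inverse, so it also solves the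
   system for edge inversion, the one that counts paths. *)
move=> a; rewrite {1}(xE a); congr (_ + _); apply: app_rho_einv => //.
apply: loop_sym_solution hK _ xE => //.
move=> b lb; rewrite !yE zE; congr (r _ + _); exact: loop_tgt_einv.
Qed.

(** The initial factor w(a) of [N_vert] is put into [B], and 1 counts the trivial path. At s = -1
    the reading is exactly [out_sum] plus source at [c0], that is [k]. *)
Lemma inverse_value_vertex (c0 : V) : c c0 = 1 ->
  inverse_value (zeta_series G w (inl c0)) (-1) chi%:C%C.
Proof.
move=> c01.
pose B a s : C := if org G a == c0 then natpowC (w a) (- s) else 0.
apply: (@inverse_value_zeta _ (fun a => (tgt G a == c0)%:R) (fun=> 0)
  (fun v => (v == c0)%:R) (fun=> 1) B c0) => //.
- exact: exppoly_cst.
- move=> a; rewrite /B; case: eqP => _; [exact: exppoly_natpowC|exact: exppoly_cst].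
- by move=> a; rewrite addr0.
- rewrite (bigD1 c0)//= eqxx c01 mulr1 big1 ?addr0; last first.
    by move=> v /negbTE ->; rewrite mulr0.
  by rewrite big1 ?mulr0 ?addr0// => a _; rewrite mulr0.
- move=> x k kv _; rewrite -(kv c0) eqxx addrC; congr (_ + _).
  rewrite /out_sum [RHS]big_mkcond; apply: eq_bigr => a _.
  rewrite /B; case: eqP => _; last by rewrite mul0r.
  by rewrite opprK natpowC_at1// (leq_trans _ (w2 a)).
move=> s x hM s0 xE; rewrite /zeta_series.
set P := paths_between _ _ _.
have <- : \sum_(v | P (inl v)) natpowC (N_vert G w (inl v)) (- s) +
    \sum_(a | org G a == c0)
      natpowC (w a) (- s) * (x a - (tgt G a == c0)%:R *+ false) =
    1 + \sum_a B a s * x a.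
  congr (_ + _).
    rewrite (big_pred1 c0) ?natpowC1// => v.
    by rewrite /P /paths_between /= !orbF andbb.
  rewrite big_mkcond; apply: eq_bigr => a _.
  by rewrite /B subr0; case: ifP; rewrite ?mul0r.
apply: (@has_sum_paths R V E G w w2 s hM P
  (fun p => natpowC (N_vert G w p) (- s)) (fun a => natpowC (w a) (- s)) x
  (fun a => org G a == c0) (fun a => tgt G a == c0) false) => //.
- by move=> a l; rewrite natpowCM ?(leq_trans _ (w2 a))//; exact: N_edg_gt0.
- by move=> a; apply: norm_natpowC_le1 => //; exact: leq_trans (w2 a).
- move=> a l; rewrite /P /paths_between /= !orbF andbT.
  by rewrite andbCA.
Qed.

(** Summing [x] over [a0] and its inverse includes the two paths of length 1, each of value 1,
    whereas the series starts from a single 1; hence the constant -1 = 1 - 2. At s = -1 this gives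
    (k + 1) - 1 = k. *)
Lemma inverse_value_edge (a0 : E) : edge_weight G w c a0 = 1 ->
  inverse_value (zeta_series G w (inr a0)) (-1) chi%:C%C.
Proof.
move=> W1; have na : einv G a0 == a0 = false by exact/eqP/einv_neq.
pose S a := (a == a0) || (a == einv G a0).
have sumS (F : E -> C) : \sum_(a | S a) F a = F a0 + F (einv G a0).
  rewrite (bigD1 a0) /S ?eqxx//=; congr (_ + _).
  rewrite (big_pred1 (einv G a0))// => a /=.
  case: (eqVneq a a0) => [->|] /=; first by rewrite eq_sym na.
  by rewrite andbT.
have Ssum (F : E -> C) : \sum_a (S a)%:R * F a = F a0 + F (einv G a0).
  rewrite -sumS [RHS]big_mkcond; apply: eq_bigr => a _.
  by case: (S a); rewrite ?mul1r ?mul0r.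
have v0 := org G a0.
apply: (@inverse_value_zeta _ (fun a => (S a)%:R) (fun a => (S a)%:R)
  (fun=> 0) (fun=> -1) (fun a _ => (S a)%:R) v0) => //.
- exact: exppoly_cst.
- by move=> a; exact: exppoly_cst.
- by move=> a; rewrite add0r.
- by move=> a; rewrite /S (inj_eq (can_inj (einvK G))) -{1}(einvK G a0)
    (inj_eq (can_inj (einvK G))) orbC.
- rewrite big1 ?add0r; last by move=> v _; rewrite mulr0.
  under eq_bigr do rewrite mulrC.
  by rewrite Ssum edge_weight_einv// W1 rmorph1; field.
- move=> x k _ ka; rewrite Ssum ka /S eqxx /=; ring.
move=> s x hM s0 xE; rewrite /zeta_series.
set P := paths_between _ _ _.
exists (\sum_(a | S a) (x a - 1)); last first.
  rewrite sumS Ssum; ring.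
have -> : \sum_(a | S a) (x a - 1) =
    \sum_(v | P (inl v) && (2 <= glength (inl v : gpath V E))%N)
       natpowC (N_edg G w (inl v)) (- s) +
    \sum_(a | S a) 1 * (x a - (S a)%:R *+ true).
  rewrite [X in _ = X + _]big_pred0 ?add0r; last by move=> v; rewrite andbC.
  by apply: eq_bigr => a ->; rewrite mul1r mulr1n.
apply: (@has_sum_paths R V E G w w2 s hM (fun p => P p && (2 <= glength p)%N)
  (fun p => natpowC (N_edg G w p) (- s)) (fun=> 1) x S S true) => //.
- by move=> a l; rewrite mul1r.
- by move=> a; rewrite normr1.
- move=> a l; rewrite /P /paths_between /= !orbF /S.
  by case: (path _ _ _); rewrite /= ?andbF // andbA.
Qed.

End ZetaValue.

Theorem theoremE (R : realType) (V E : finType) (Gam : graph V E)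
    (w : E -> nat)
    (Gam_nonempty : inhabited V)
    (Gam_connected : connected_graph Gam)
    (Gam_cycles : forall c : seq E, is_cycle Gam c -> (size c < 2)%N)
    (w_ge2 : forall a : E, (2 <= w a)%N)
    (w_ge3 : forall a : E, (3 <= w a)%N \/ (3 <= w (einv Gam a))%N)
    (VT ET : choiceType) (T : graph VT ET) (prj : ghom T Gam)
    (T_cover : is_universal_cover w prj)
    (Gam_unimodular : unimodular R (aut_pi prj))
    (u : V + E) (t : VT + ET) (tu : hom_cell prj t = u)
    (mu : {measure set (borel (aut_pi prj)) -> \bar R})
    (mu_haar : left_haar mu) (mu_t : mu (stab prj t) = 1%:E)
    (Bv O Be : set (VT + ET))
    (Bv_repr : orbit_representatives prj (vertices VT ET) Bv)
    (O_orient : invariant_orientation prj O)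
    (Be_repr : orbit_representatives prj O Be) :
  inverse_value (zeta_series Gam w u) (-1) (euler_char mu Bv Be)%:C%C.
Proof.
have mu_right := Gam_unimodular mu mu_haar.
have [c [c_gt0 c_balance cv ce]] := base_weight T_cover w_ge2 mu_haar mu_right mu_t.
have wt : cell_weight mu t = 1 by rewrite /cell_weight mu_t /= invr1.
have -> : euler_char mu Bv Be = chi Gam w c.
  exact: (euler_char_base T_cover w_ge2 cv ce Bv_repr O_orient Be_repr).
case: u tu => [c0|a0] tu; case: t tu wt {mu_t} => [v|e] //= [tu] wt.
- by apply: inverse_value_vertex => //; rewrite -tu -cv.
- by apply: inverse_value_edge => //; rewrite /edge_weight -tu -ce.
Qed.
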